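(* Let $g$ be a positive integer and let $G$ be a finite simple planar graph of girth at least $g$ with exactly $b$ bridges. Then $$\mathrm{fvs}(G)\leq \left\lfloor \frac{e(G)-b}{g}\right\rfloor.$$
   Context: For a graph $G$, $e(G)$ denotes its number of edges. A feedback vertex set of $G$ is a set $S\subseteq V(G)$ such that $G-S$ (the graph obtained by deleting the vertices of $S$) is a forest, i.e. contains no cycle; $\mathrm{fvs}(G)$ is the minimum size of a feedback vertex set of $G$. $G$ has girth at least $g$ if every cycle of $G$ has length at least $g$ (a forest satisfies this for every $g$). A bridge is an edge that by itself forms an edge cut, where an edge cut is a set $\delta_G(X)$ of all edges having exactly one end in $X$, for some $X\subseteq V(G)$. *)

(* Defs.v *)
From HB Require Import structures.
From mathcomp Require Import all_boot all_order all_algebra.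
From mathcomp Require Import all_classical all_reals all_analysis.
Import Order.TTheory GRing.Theory Num.Theory.
Import numFieldNormedType.Exports.

Set Implicit Arguments.
Unset Strict Implicit.
Unset Printing Implicit Defensive.

Record sgraph := SGraph {
  vertex :> finType;
  adj : rel vertex;
  adj_sym : symmetric adj;
  adj_irr : irreflexive adj }.

Definition edges (G : sgraph) : {set {set G}} :=
  [set f : {set G} | [exists x, exists y, adj x y && (f == [set x; y])]].

Definition edge_cut (G : sgraph) (X : {set G}) : {set {set G}} :=
  [set f in edges G | #|f :&: X| == 1].

Definition bridges (G : sgraph) : {set {set G}} :=
  [set f in edges G | [exists X : {set G}, edge_cut X == [set f]]].

(* [ucycle] alone also accepts the empty sequence and, for an edge xy,
   the sequence [:: x; y]. *)
Definition graph_cycle (G : sgraph) (c : seq G) : bool :=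
  ucycleb (@adj G) c && (2 < size c).

Definition girth_at_least (G : sgraph) (g : nat) : Prop :=
  forall c : seq G, graph_cycle c -> g <= size c.

Definition forest (G : sgraph) : Prop := forall c : seq G, ~~ graph_cycle c.

Section DeleteVertices.
Variables (G : sgraph) (S : {set G}).

Definition del_adj : rel {x : G | x \notin S} :=
  fun u v => adj (val u) (val v).

Lemma del_sym : symmetric del_adj.
Proof. by move=> u v; apply: adj_sym. Qed.

Lemma del_irr : irreflexive del_adj.
Proof. by move=> u; apply: adj_irr. Qed.

Definition delete_vertices : sgraph := SGraph del_sym del_irr.

End DeleteVertices.

Definition feedback_vertex_set (G : sgraph) (S : {set G}) : Prop :=
  forest (delete_vertices S).

Definition fvs (G : sgraph) : nat :=
  #|[arg min_(S < [set: G] | `[< feedback_vertex_set S >]) #|S| ]|.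

Lemma feedback_vertex_setT (G : sgraph) : feedback_vertex_set [set: G].
Proof. by case=> [//|[x Sx] c]; have := Sx; rewrite finset.in_setT. Qed.

Lemma fvsP (G : sgraph) :
  (exists2 S : {set G}, feedback_vertex_set S & #|S| = fvs G) /\
  (forall S : {set G}, feedback_vertex_set S -> fvs G <= #|S|).
Proof.
rewrite /fvs; case: arg_minnP; first exact/asboolP/feedback_vertex_setT.
move=> S /asboolP fS minS; split; first by exists S.
by move=> S' fS'; apply/minS/asboolP.
Qed.

Local Open Scope ring_scope.

(* A drawing of G in the real plane. The curves are parametrised by [0, 1];
   the values of [curve] on non-edges, and of [curve f] outside [0, 1], are
   irrelevant. *)
Record plane_drawing (R : realType) (G : sgraph)
    (pos : G -> R * R) (curve : {set G} -> R -> R * R) : Prop := {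
  drawing_pos_inj : injective pos;
  drawing_continuous : forall f, f \in edges G ->
    {within `[0, 1], continuous (curve f)}%classic;
  drawing_curve_inj : forall f, f \in edges G ->
    {in `[0, 1] &, injective (curve f)};
  drawing_ends : forall f, f \in edges G -> exists x y : G,
    [/\ f = [set x; y], curve f 0 = pos x & curve f 1 = pos y];
  drawing_avoids_vertices : forall f, f \in edges G ->
    forall (t : R) (x : G), t \in `]0, 1[ -> curve f t <> pos x;
  drawing_no_crossing : forall f h, f \in edges G -> h \in edges G -> f != h ->
    forall s t : R, s \in `]0, 1[ -> t \in `]0, 1[ -> curve f s <> curve h t }.

Definition planar (R : realType) (G : sgraph) : Prop :=
  exists (pos : G -> R * R) (curve : {set G} -> R -> R * R),
    plane_drawing pos curve.

(* Main.v *)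
Require Import Defs.
From HB Require Import structures.
From mathcomp Require Import all_boot all_order all_algebra zify ring lra.
From mathcomp Require Import all_classical all_reals all_analysis.
From mathcomp Require Import fintype finset.

Set Implicit Arguments.
Unset Strict Implicit.
Unset Printing Implicit Defensive.

Import Order.TTheory GRing.Theory Num.Theory numFieldNormedType.Exports.

(** Write beta(H) for the dimension of the cycle space over F_2 of a graph H and
    w(H) for the number of edges of H that are not bridges of G. The proof
    combines a property of planar graphs with a min-max argument about
    arbitrary graphs.

    The planar ingredient is [face_count]: if H is a subgraph of G with a cycle,
    then g (beta(H) + 1) <= 2 w(H). Indeed the boundaries of the faces of H span
    its cycle space and add up to zero, so that at least beta(H) + 1 of them are
    nonzero; a nonzero element of the cycle space contains a cycle, hence at
    least g edges, and contains no bridge; and every edge lies on at most two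
    face boundaries.

    The other ingredient is [parity_bound]. Choose a largest family N of
    disjoint pairs of adjacent edges whose union can be removed from G so that
    beta drops by 2 |N|, and extend this union to beta(G) edges whose removal
    leaves a forest. The common ends of the pairs, together with one end of
    each further edge, form a feedback vertex set of beta(G) - |N| vertices.
    It remains to see that g (beta(G) - |N|) <= w(G), and one argues by
    induction on the number of edges. An edge that can be deleted without
    lowering beta - |N| is deleted, and a disconnected graph is split. In the
    remaining case each edge is avoided by some optimal family, and Gallai's
    argument for factor-critical graphs, carried over from matchings to this
    matroid parity problem ([gallai_bound]), shows that beta <= 2 |N| + 1. Then
    2 g (beta - |N|) <= g (beta + 1) <= 2 w by the first ingredient.

    Faces are obtained without the Jordan curve theorem. On a fine enough
    lattice the drawing shows that G is a minor of a finite grid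
    ([drawing_grid_minor]): compactness keeps discs around the vertices and the
    parts of the curves outside them apart. The faces of the grid are unit
    squares, and a cycle of the grid is the boundary of the squares with odd
    winding number, which can be counted along a vertical ray
    ([potential_edge]). Contraction keeps the faces, deletion of an edge merges
    the two faces beside it, and so the description of the cycle space by face
    boundaries passes from the grid to its minors ([minor_cycle_face],
    [minor_face_cycle]). *)

(** * Nullity and pairs of adjacent edges *)

Lemma setU_compl (T : finType) (A B : {set T}) : A \subset B -> A :|: (B :\: A) = B.
Proof.
move=> /subsetP sAB; apply/setP=> x; rewrite !inE.
by have := sAB x; case: (x \in A) => //= ->.
Qed.

Lemma disjoint_compl (T : finType) (A B : {set T}) : [disjoint A & B :\: A].
Proof. by rewrite -setI_eq0; apply/eqP/setP=> x; rewrite !inE; case: (x \in A). Qed.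

Section Nullity.
Variables (T : finType) (beta : {set T} -> nat).
(** [beta] abstracts the dimension of the cycle space of a set of edges. The
    laws assumed in this section, one at a time, say that it is the corank
    function of the dual of a matroid. *)
Hypothesis betaD1 : forall (A : {set T}) e, beta A <= (beta (A :\ e)).+1.

(** For the cycle space, [coindep E D] says that [D] lies in the complement of
    a spanning forest of [E]: these are the independent sets of the cographic
    matroid of [E]. *)
Definition coindep (E D : {set T}) :=
  (D \subset E) && (beta (E :\: D) + #|D| <= beta E).

Lemma nullityD (E D : {set T}) : beta E <= beta (E :\: D) + #|D|.
Proof.
have [m] := ubnP #|D|; elim: m D => // m IH D leDm.
have [->|[x xD]] := set_0Vmem D; first by rewrite setD0 leq_addr.
have cD := cardsD1 x D; rewrite xD in cD.
have := IH (D :\ x); have := betaD1 (E :\: (D :\ x)) x.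
have -> : E :\: (D :\ x) :\ x = E :\: D.
  apply/setP=> y; rewrite !inE; have [->|//] := eqVneq y x.
  by rewrite xD.
lia.
Qed.

Lemma coindep_card E D : coindep E D -> beta (E :\: D) + #|D| = beta E.
Proof. by case/andP=> _ h; apply/eqP; rewrite eqn_leq h nullityD. Qed.

Lemma coindepS (E D D' : {set T}) : D' \subset D -> coindep E D -> coindep E D'.
Proof.
move=> sD /andP[sDE h]; rewrite /coindep (subset_trans sD sDE) /=.
have := nullityD (E :\: D') (D :\: D').
have -> : E :\: D' :\: (D :\: D') = E :\: D.
  apply/setP=> y; rewrite !inE.
  by have := subsetP sD y; case: (y \in D'); case: (y \in D) => // /(_ isT).
have := cardsID D' D; rewrite (setIidPr sD); lia.
Qed.

Hypothesis beta_super : forall A B : {set T},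
  beta A + beta B <= beta (A :|: B) + beta (A :&: B).

(** Deleting one edge at a time may be replaced by deleting all of them: by
    supermodularity, an edge that is useless in [F] stays useless in every
    smaller set. *)
Lemma nullity_stable (F X : {set T}) :
  (forall x, x \in X -> beta F <= beta (F :\ x)) -> beta F <= beta (F :\: X).
Proof.
have [m] := ubnP #|X|; elim: m X => // m IH X leXm hX.
have [->|[x xX]] := set_0Vmem X; first by rewrite setD0.
have cX := cardsD1 x X; rewrite xX in cX.
have h1 : beta F <= beta (F :\: (X :\ x)).
  by apply: IH => [|y /setD1P[_ /hX]] //; lia.
have h2 := hX x xX.
have := beta_super (F :\: (X :\ x)) (F :\ x).
have -> : (F :\: (X :\ x)) :|: (F :\ x) = F.
  apply/setP=> y; rewrite !inE; case: (y \in F); rewrite ?andbF //= !andbT.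
  by case: (y == x); rewrite ?orbT.
have -> : (F :\: (X :\ x)) :&: (F :\ x) = F :\: X.
  apply/setP=> y; rewrite !inE; case: (y \in F); rewrite ?andbF //= !andbT.
  by have [->|_] := eqVneq y x; rewrite ?xX ?andbF ?andbT.
lia.
Qed.

Lemma coindepU1 (E A : {set T}) x : coindep E A -> x \in E :\: A ->
  ~~ coindep E (x |: A) -> beta (E :\: A) <= beta (E :\: A :\ x).
Proof.
move=> iA /setDP[xE xA]; rewrite /coindep subUset sub1set xE /=.
have := coindep_card iA; case/andP: iA => -> _ /=; rewrite cardsU1 xA.
by rewrite (_ : E :\: (x |: A) = E :\: A :\ x) 1?setUC ?setDDl //; lia.
Qed.

Hypothesis beta0 : beta set0 = 0.

Lemma coindep_extend (E A : {set T}) : coindep E A -> #|A| < beta E ->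
  exists2 x, x \in E :\: A & coindep E (x |: A).
Proof.
move=> iA ltAE.
have [/exists_inP[x xB xi]|] := boolP [exists x in E :\: A, coindep E (x |: A)].
  by exists x.
rewrite negb_exists_in => /forall_inP hB.
have := @nullity_stable (E :\: A) (E :\: A); rewrite setDv beta0.
have := coindep_card iA => h1 h2.
suff : beta (E :\: A) <= 0 by lia.
by apply: h2 => x xEA; apply: coindepU1 => //; exact: hB.
Qed.

Lemma coindep_basis (E A : {set T}) : coindep E A ->
  exists D : {set T}, [/\ A \subset D, coindep E D & #|D| = beta E].
Proof.
have [m] := ubnP (beta E - #|A|); elim: m A => // m IH A lem iA.
have := coindep_card iA => cA.
have [le|lt] := leqP (beta E) #|A|; first by exists A; split=> //; lia.
have [x /setDP[_ xA] iAx] := coindep_extend iA lt.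
have cAx : #|x |: A| = #|A|.+1 by rewrite cardsU1 xA.
have [|D [sD iD cD]] := IH _ _ iAx; first by lia.
by exists D; split=> //; apply: subset_trans sD; apply: subsetUr.
Qed.

Hypothesis betaS : forall A B : {set T}, A \subset B -> beta A <= beta B.

(** The exchange axiom of matroids. If no element of [B] could be added to [A],
    then deleting all of [B] on top of [A] would not lower the nullity, and
    [B] would be no larger than [A]. *)
Lemma coindep_augment (E A B : {set T}) :
  coindep E A -> coindep E B -> #|A| < #|B| ->
  exists2 x, x \in B :\: A & coindep E (x |: A).
Proof.
move=> iA iB ltAB.
have [/exists_inP[x xB xi]|] := boolP [exists x in B :\: A, coindep E (x |: A)].
  by exists x.
rewrite negb_exists_in => /forall_inP hB.
have sBE : B \subset E by case/andP: iB.
have := @nullity_stable (E :\: A) (B :\: A).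
have -> : E :\: A :\: (B :\: A) = E :\: (A :|: B).
  by apply/setP=> y; rewrite !inE; case: (y \in A); rewrite ?andbF.
have le2 : beta (E :\: (A :|: B)) <= beta (E :\: B) by apply/betaS/setDS/subsetUr.
have := coindep_card iA; have := coindep_card iB => h1 h2 h3.
suff : beta (E :\: A) <= beta (E :\: (A :|: B)) by lia.
apply: h3 => x xBA; apply: coindepU1 => //; last exact: hB.
by move: xBA; rewrite !inE => /andP[-> /(subsetP sBE)].
Qed.

Lemma coindep_complete (E A B : {set T}) :
  coindep E A -> coindep E B -> #|A| <= #|B| ->
  exists A' : {set T}, [/\ A \subset A', A' \subset A :|: B, coindep E A' & #|A'| = #|B|].
Proof.
have [m] := ubnP (#|B| - #|A|); elim: m A => // m IH A lem iA iB leAB.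
have [lt|ge] := ltnP #|A| #|B|; last first.
  by exists A; rewrite subsetUl; split=> //; apply/eqP; rewrite eqn_leq leAB ge.
have [z /setDP[zB zA] izA] := coindep_augment iA iB lt.
have czA : #|z |: A| = #|A|.+1 by rewrite cardsU1 zA.
have [|//||A' [s1 s2 i2 c]] := IH _ _ izA; rewrite ?czA //.
  by move: lem; rewrite ltnS subnS; apply: leq_trans; rewrite ltn_predL subn_gt0.
exists A'; split=> //; first by apply: subset_trans s1; apply: subsetUr.
apply: subset_trans s2 _; rewrite !subUset sub1set inE zB orbT.
by rewrite subsetUl subsetUr.
Qed.

Section Matching.
Variable adjT : rel T.
Hypothesis adjT_sym : symmetric adjT.

Definition adjacent_pair (B : {set T}) :=
  [exists x, exists y, [&& x != y, adjT x y & B == [set x; y]]].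

(** A matching whose edges are the adjacent pairs; for edges of a graph, a
    family of disjoint paths of length two. *)
Definition pairing (N : {set {set T}}) :=
  trivIset N && [forall B in N, adjacent_pair B].

(** The feasible sets of the matroid parity problem whose matroid is the
    cographic one and whose lines are all the pairs of adjacent edges. *)
Definition parity_set E N := pairing N && coindep E (cover N).

Lemma adjacent_pairP B x : adjacent_pair B -> x \in B ->
  exists y, [/\ x != y, adjT x y & B = [set x; y]].
Proof.
case/existsP=> a /existsP[b /and3P[ab adab /eqP->]].
rewrite !inE => /orP[]/eqP->; first by exists b.
by exists a; rewrite eq_sym adjT_sym setUC.
Qed.

Lemma card_adjacent_pair B : adjacent_pair B -> #|B| = 2.
Proof. by case/existsP=> a /existsP[b /and3P[ab _ /eqP->]]; rewrite cards2 ab. Qed.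

Lemma pairingP N B : pairing N -> B \in N -> adjacent_pair B.
Proof. by case/andP=> _ /forall_inP h /h. Qed.

Lemma card_pairing N : pairing N -> #|cover N| = (2 * #|N|)%N.
Proof.
move=> pN; have /andP[/eqP<- _] := pN.
rewrite (eq_bigr (fun=> 2)) ?sum_nat_const 1?mulnC // => B /(pairingP pN).
exact: card_adjacent_pair.
Qed.

Lemma pairingD1 N B : pairing N -> pairing (N :\ B).
Proof.
move=> pN; apply/andP; split.
  by case/andP: pN => t _; apply: trivIsetS t; apply: subD1set.
by apply/forall_inP=> C /setD1P[_]; apply: pairingP.
Qed.

Lemma pairingU1 N B : pairing N -> adjacent_pair B -> [disjoint B & cover N] ->
  pairing (B |: N) /\ #|B |: N| = #|N|.+1.
Proof.
move=> pN aB dBN.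
have nB : B \notin N.
  apply: contraL dBN => BN; have /existsP[a /existsP[b /and3P[_ _ /eqP eB]]] := aB.
  apply/negP=> /pred0P /(_ a) /=; rewrite {1}eB !inE eqxx /= => /negP; apply.
  by apply/bigcupP; exists B; rewrite // eB !inE eqxx.
split; last by rewrite cardsU1 nB.
apply/andP; split; last first.
  by apply/forall_inP=> C /setU1P[-> //|]; apply: pairingP.
case/andP: (pN) => /trivIsetP t _; apply/trivIsetP => C C' /setU1P[->|CN] /setU1P[->|C'N].
- by rewrite eqxx.
- move=> _; apply: disjointWr dBN; exact: bigcup_sup.
- move=> _; rewrite disjoint_sym; apply: disjointWr dBN; exact: bigcup_sup.
- exact: t.
Qed.

Lemma coverU1 (N : {set {set T}}) (B : {set T}) : cover (B |: N) = B :|: cover N.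
Proof. by rewrite /cover bigcup_setU big_set1. Qed.

Section Gallai.
Variables (E : {set T}) (nu : nat).
Hypothesis nu_max : forall N, parity_set E N -> #|N| <= nu.
Hypothesis avoidable : forall h, h \in E ->
  exists N, [/\ pairing N, #|N| = nu, h \notin cover N & coindep E (h |: cover N)].

(** How every contradiction below arises: an optimal pairing that leaves two
    adjacent elements free and still independent could be enlarged. *)
Lemma no_larger N x y : pairing N -> #|N| = nu -> x \notin cover N -> y \notin cover N ->
  x != y -> adjT x y -> coindep E (x |: (y |: cover N)) -> False.
Proof.
move=> pN cN xN yN xy axy i.
have [||p c] := @pairingU1 N [set x; y] pN.
- by apply/existsP; exists x; apply/existsP; exists y; rewrite xy axy /=.
- rewrite disjoint_sym disjoints_subset; apply/subsetP=> z zN; rewrite !inE.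
  by apply: contraL zN => /orP[]/eqP->.
have := nu_max (N := [set x; y] |: N); rewrite c /parity_set p coverU1 -setUA i => /(_ isT).
by rewrite cN ltnn.
Qed.

(** The exchange behind the theorem: a pair of [N] that touches [x] can be
    swapped into [Nh] against some pair foreign to [N], so that [Nh] moves
    towards [N] without covering [h]. If the partner [y] of [x] is covered by
    [Nh], the pair to give up is the one through [y]; otherwise independence
    of [N] yields an element [z], covered by [Nh] and not by [N], whose
    removal makes room for [x] and [y]. *)
Lemma gallai_swap N Nh h x : pairing N -> #|N| = nu -> coindep E (cover N) ->
  pairing Nh -> #|Nh| = nu -> h \notin cover Nh ->
  x \in cover N -> x \notin h |: cover Nh -> coindep E (x |: (h |: cover Nh)) ->
  exists N', [/\ pairing N', #|N'| = nu, h \notin cover N', coindep E (h |: cover N')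
    & #|Nh :&: N| < #|N' :&: N|].
Proof.
move=> pN cN iN pNh cNh hNh /bigcupP[B BN xB] xh ixh.
have [y [xy axy eB]] := adjacent_pairP (pairingP pN BN) xB.
move: xh; rewrite !inE negb_or => /andP[xneh xNh].
have BNh : B \notin Nh by apply: contra xNh => ?; apply/bigcupP; exists B.
suff [B' [B'Nh B'N yB' hy iB']] : exists B' : {set T}, [/\ B' \in Nh, B' \notin N,
    y \notin cover (Nh :\ B'), y != h & coindep E (h |: (B :|: cover (Nh :\ B')))].
  have sc : cover (Nh :\ B') \subset cover Nh.
    apply/subsetP=> z /bigcupP[C /setD1P[_ CN] zC]; apply/bigcupP; by exists C.
  have [|p c] := @pairingU1 (Nh :\ B') B (pairingD1 B' pNh) (pairingP pN BN).
    rewrite eB disjoint_sym disjoints_subset; apply/subsetP=> z zN; rewrite !inE.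
    apply: contraL zN => /orP[]/eqP-> //; apply: contra xNh; exact: (subsetP sc).
  exists (B |: (Nh :\ B')); split=> //.
  - by rewrite c -cNh (cardsD1 B' Nh) B'Nh.
  - rewrite coverU1 eB !inE negb_or; rewrite eq_sym (negPf xneh) eq_sym (negPf hy) /=.
    by apply: contra hNh; exact: (subsetP sc).
  - by rewrite coverU1.
  rewrite (_ : (B |: Nh :\ B') :&: N = B |: (Nh :&: N)); last first.
    apply/setP=> C; rewrite !inE; have [->|nCB] := eqVneq C B; first by rewrite BN.
    by have [->|_ //] := eqVneq C B'; rewrite (negPf B'N) !andbF.
  by rewrite cardsU1 inE (negPf BNh).
have [yNh|yNh] := boolP (y \in cover Nh).
  have /bigcupP[B' B'Nh yB'] := yNh; exists B'.
  have B'ne : B' != B by apply: contraNneq BNh => <-.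
  split=> //.
  - apply: contra B'ne => B'N; apply/eqP; case/andP: pN => /trivIsetP t _.
    have [//|ne] := eqVneq B' B.
    have := t _ _ B'N BN ne => /pred0P /(_ y) /=; rewrite yB' eB !inE eqxx orbT.
    by [].
  - apply/negP=> /bigcupP[C /setD1P[CB' CN] yC].
    have := (andP pNh).1 => /trivIsetP /(_ _ _ CN B'Nh CB') /pred0P /(_ y) /=.
    by rewrite yC yB'.
  - by apply: contraNneq hNh => <-.
  apply: coindepS ixh; apply/subsetP=> z; rewrite eB !inE.
  case/or3P=> [->|/orP[->|/eqP->]|]; rewrite ?yNh ?orbT //.
  case/bigcupP=> C /setD1P[_ CN] zC; apply/or3P/Or33/bigcupP; by exists C.
have hy : y != h.
  apply/eqP=> yh; apply: (@no_larger Nh x h) => //; by rewrite -yh.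
pose A := x |: (y |: (cover N :&: cover Nh)).
have yN : y \in cover N by apply/bigcupP; exists B; rewrite // eB !inE eqxx orbT.
have xN : x \in cover N by apply/bigcupP; exists B.
have iA : coindep E A.
  by apply: coindepS iN; rewrite !subUset !sub1set xN yN subsetIl.
have c2 : #|x |: (h |: cover Nh)| = (2 * nu).+2.
  by rewrite !cardsU1 !inE negb_or xneh xNh hNh card_pairing // cNh.
(* the enlarged [A] omits exactly one element [z], which [N] does not cover *)
have [|A' [sAA' sA' iA' cA']] := coindep_complete iA ixh.
  have sAN : A \subset cover N by rewrite !subUset !sub1set xN yN subsetIl.
  move/subset_leq_card: sAN; rewrite (card_pairing pN) cN c2 => le.
  by do 2 apply: leqW.
rewrite c2 in cA'.
have {}sA' : A' \subset y |: (x |: (h |: cover Nh)).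
  apply: subset_trans sA' _; apply/subsetP=> z; rewrite !inE.
  by case/or4P=> [/orP[->|/orP[->|/andP[_ ->]]]|->|->|->]; rewrite ?orbT.
have [z zy zA'] : exists2 z, z \in y |: (x |: (h |: cover Nh)) & z \notin A'.
  apply/subsetPn; apply: contraTN isT => sub; have := subset_leq_card sub.
  by rewrite cardsU1 c2 cA' !inE !negb_or eq_sym xy hy yNh add1n ltnn.
have zA : z \notin A by apply: contra zA'; apply: (subsetP sAA').
have eA' : A' = (y |: (x |: (h |: cover Nh))) :\ z.
  apply/eqP; rewrite eqEcard; apply/andP; split.
    apply/subsetP=> t tA'; rewrite in_setD1 (subsetP sA') // andbT.
    by apply: contraNneq zA' => <-.
  rewrite cA'; have := cardsD1 z (y |: (x |: (h |: cover Nh))); rewrite zy.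
  by rewrite cardsU1 c2 !inE !negb_or eq_sym xy hy yNh !add1n => -[->].
have zneh : z != h.
  apply/eqP=> zh; apply: (@no_larger Nh x y) => //; apply: coindepS iA'.
  rewrite eA' zh; apply/subsetP=> t; rewrite !inE => tt.
  have -> : t != h by apply: contraL tt => /eqP->; rewrite eq_sym (negPf xneh) eq_sym (negPf hy).
  by case/or3P: tt => ->; rewrite ?orbT.
move: zA zy; rewrite !inE !negb_or => /and3P[zx zyy zN] /or4P[].
- by rewrite (negPf zyy).
- by rewrite (negPf zx).
- by rewrite (negPf zneh).
move=> zNh; move: zN; rewrite zNh andbT => zN.
have /bigcupP[B' B'Nh zB'] := zNh; exists B'; split=> //.
- by apply: contra zN => B'N; apply/bigcupP; exists B'.
- apply: contra yNh => /bigcupP[C /setD1P[_ CN] yC]; apply/bigcupP; by exists C.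
apply: coindepS iA'; rewrite eA'; apply/subsetP=> t; rewrite !inE => tt.
have -> : t != z.
  apply: contraL tt => /eqP->; rewrite (negPf zneh) eB !inE (negPf zx) (negPf zyy) /=.
  apply/negP=> /bigcupP[C /setD1P[CB' CN] zC].
  have := (andP pNh).1 => /trivIsetP /(_ _ _ CN B'Nh CB') /pred0P /(_ z) /=.
  by rewrite zC zB'.
case/or3P: tt => [->|tB|/bigcupP[C /setD1P[_ CN] tC]]; rewrite ?orbT //.
  by move: tB; rewrite eB !inE => /orP[]->; rewrite ?orbT.
by apply/or4P/Or44/bigcupP; exists C.
Qed.

(** Gallai's argument for factor-critical graphs, by induction on the distance
    of the two free elements [e] and [f]. Let [h] follow [e] on the path, and
    among the optimal pairings that avoid [h] let [Nh] share as many pairs as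
    possible with [N]. As [N] has two free elements and [Nh] only [h], some
    [x] in the larger set extends the smaller. If [x] is [e] or [f], the
    induction hypothesis applies to [h] and [x]; otherwise [gallai_swap]
    contradicts the choice of [Nh]. *)
Lemma gallai_path N e f p : pairing N -> #|N| = nu -> e \notin cover N -> f \notin cover N ->
  e != f -> coindep E (e |: (f |: cover N)) ->
  path [rel a b | adjT a b && (b \in E)] e p -> f = last e p -> False.
Proof.
have [m] := ubnP (size p); elim: m N e f p => // m IH N e f [|h p] /= lem pN cN eN fN ef i.
  by move=> _ fe; rewrite fe eqxx in ef.
case/andP=> /andP[aeh hE] php fl.
have eE : e \in E by case/andP: i => /subsetP s _; apply: s; rewrite !inE eqxx.
have [p0|p0] := eqVneq p [::].
  rewrite p0 /= in fl; apply: (@no_larger N e f) => //; by rewrite fl.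
have sp : 0 < size p by case: (p) p0.
have iN : coindep E (cover N).
  by apply: coindepS i; rewrite setUA subsetUr.
have [Nh0 [pNh0 cNh0 hNh0 iNh0]] := avoidable hE.
pose P Nh := [&& pairing Nh, #|Nh| == nu, h \notin cover Nh & coindep E (h |: cover Nh)].
have P0 : P Nh0 by rewrite /P pNh0 cNh0 eqxx hNh0.
case: (@arg_maxnP _ Nh0 P (fun Nh => #|Nh :&: N|) P0) => Nh /and4P[pNh /eqP cNh hNh iNh] mx.
have [|x xD ix] := coindep_augment iNh i.
  rewrite !cardsU1 !inE negb_or ef eN fN hNh (card_pairing pN) (card_pairing pNh) cN cNh.
  by rewrite !add1n ltnS.
case/setDP: xD => xi; rewrite !inE negb_or => /andP[xneh xNh].
move: xi; rewrite !inE => /or3P[/eqP xe|/eqP xf|xN].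
- apply: (IH Nh e h [:: h]) => //=; rewrite -?xe //; first exact: leq_ltn_trans sp lem.
  by rewrite xe aeh hE.
- apply: (IH Nh h f p) => //=; rewrite -?xf //; first by rewrite eq_sym.
  by rewrite setUCA.
have [||N' [pN' cN' hN' iN' lt]] := @gallai_swap N Nh h x pN cN iN pNh cNh hNh xN => //.
  by rewrite !inE negb_or xneh.
have := mx N'; rewrite /P pN' cN' eqxx hN' iN' => /(_ isT) /(leq_trans lt).
by rewrite ltnn.
Qed.

(** If every element is avoided by an optimal pairing and the adjacency relation
    is connected, an optimal pairing leaves at most one element of a basis
    unpaired. *)
Lemma gallai_bound (N : {set {set T}}) : parity_set E N -> #|N| = nu ->
  (forall e f, e \in E -> f \in E ->
     exists2 p, path [rel a b | adjT a b && (b \in E)] e p & f = last e p) ->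
  beta E <= (2 * nu).+1.
Proof.
move=> /andP[pN iN] cN conn; rewrite leqNgt; apply/negP=> lt.
have [|f /setDP[fE fN] if1] := coindep_extend iN; first by rewrite card_pairing ?cN; lia.
have [|e /setDP[eE eN] ie] := coindep_extend if1.
  by rewrite cardsU1 fN card_pairing ?cN.
move: eN; rewrite !inE negb_or => /andP[ef eN].
have [p pp fl] := conn e f eE fE.
exact: (gallai_path pN cN eN fN ef ie pp fl).
Qed.

End Gallai.

(** For graphs: the cycle space of a disjoint union is the sum of those of the
    parts. It is here that the adjacency relation and the matroid interact. *)
Hypothesis beta_split : forall A B : {set T},
  (forall x y, x \in A -> y \in B -> ~~ adjT x y) -> beta (A :|: B) <= beta A + beta B.

(** Optimal pairings of two parts without adjacency between them can be put
    side by side, because then nullity is additive. *)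
Lemma parity_setU (A B : {set T}) (N1 N2 : {set {set T}}) : [disjoint A & B] ->
  (forall x y, x \in A -> y \in B -> ~~ adjT x y) ->
  pairing N1 -> coindep A (cover N1) -> pairing N2 -> coindep B (cover N2) ->
  parity_set (A :|: B) (N1 :|: N2) /\ #|N1 :|: N2| = #|N1| + #|N2|.
Proof.
move=> dAB nadj pN1 iN1 pN2 iN2.
have s1 : cover N1 \subset A by case/andP: iN1.
have s2 : cover N2 \subset B by case/andP: iN2.
have cU : cover (N1 :|: N2) = cover N1 :|: cover N2 by rewrite /cover bigcup_setU.
have dN : [disjoint cover N1 & cover N2] by apply: disjointWl s1 (disjointWr s2 dAB).
have pU : pairing (N1 :|: N2).
  apply/andP; split; last first.
    by apply/forall_inP=> C /setUP[]; apply: pairingP.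
  have [/trivIsetP t1 /trivIsetP t2] := ((andP pN1).1, (andP pN2).1).
  apply/trivIsetP=> C C' /setUP[CN|CN] /setUP[C'N|C'N] ne; try by [exact: t1|exact: t2].
    exact: disjointWl (bigcup_sup _ CN) (disjointWr (bigcup_sup _ C'N) dN).
  rewrite disjoint_sym.
  exact: disjointWl (bigcup_sup _ C'N) (disjointWr (bigcup_sup _ CN) dN).
have cN12 : #|cover N1 :|: cover N2| = #|cover N1| + #|cover N2|.
  by rewrite cardsU (disjoint_setI0 dN) cards0 subn0.
split; last first.
  apply/eqP; rewrite -(eqn_pmul2l (isT : 0 < 2)) -(card_pairing pU) cU cN12 mulnDr.
  by rewrite (card_pairing pN1) (card_pairing pN2).
have bsup := beta_super A B; rewrite (disjoint_setI0 dAB) beta0 addn0 in bsup.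
have bD : beta ((A :|: B) :\: (cover N1 :|: cover N2)) <=
    beta (A :\: cover N1) + beta (B :\: cover N2).
  rewrite (_ : _ :\: _ = (A :\: cover N1) :|: (B :\: cover N2)).
    by apply: beta_split => x y /setDP[xA _] /setDP[yB _]; apply: nadj.
  apply/setP=> z.
  have := subsetP s1 z; have := subsetP s2 z; have := pred0P dAB z => /=.
  rewrite !in_setD !in_setU !in_setD.
  case: (z \in A); case: (z \in B); case: (z \in cover N1); case: (z \in cover N2) => //=;
   by move=> _ h1 h2; try (by have := h1 isT); try (by have := h2 isT).
rewrite /parity_set pU cU /coindep cN12 setUSS //=.
apply: leq_trans bsup; rewrite -(coindep_card iN1) -(coindep_card iN2) addnACA.
by rewrite leq_add2r.
Qed.

Variables (ground : {set T}) (g : nat) (w : {set T} -> nat).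
Hypothesis w_add : forall A B : {set T}, [disjoint A & B] -> w A + w B <= w (A :|: B).
Hypothesis w_large : forall A : {set T}, A \subset ground -> 0 < beta A -> g * (beta A).+1 <= 2 * w A.

Lemma weightS (A B : {set T}) : A \subset B -> w A <= w B.
Proof.
move=> sAB; have := w_add (A := A) (B := B :\: A).
rewrite disjoint_compl setU_compl // => /(_ isT); lia.
Qed.

(** Induction on [E]. If some element [e] is covered by, or dependent on, every
    optimal pairing, deleting [e] does not decrease the quantity
    [beta E - #|N|], and the bound for [E :\ e] suffices. If every element
    can be avoided and [E] is connected, [gallai_bound] gives
    [2 (beta E - #|N|) <= beta E + 1] and [w_large] concludes. If [E] is
    disconnected, its parts are treated separately. *)
Theorem parity_bound (E : {set T}) : E \subset ground ->
  exists2 N, parity_set E N & g * (beta E - #|N|) <= w E.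
Proof.
have [m] := ubnP #|E|; elim: m E => // m IH E cEm sE.
have p0 : parity_set E set0.
  rewrite /parity_set /pairing /cover big_set0 /coindep sub0set setD0 cards0 addn0 leqnn !andbT.
  apply/andP; split; first by apply/trivIsetP=> A B; rewrite inE.
  by apply/forall_inP=> A; rewrite inE.
case: (@arg_maxnP _ set0 (parity_set E) (fun N => #|N|) p0) => N0 pN0 mx0.
have mx N : parity_set E N -> #|N| <= #|N0| by apply: mx0.
clear mx0.
have iN0 := coindep_card (andP pN0).2.
have cN0 := card_pairing (andP pN0).1.
have [/exists_inP[e eE /existsPn he]|] := boolP [exists e in E, ~~ [exists N,
   [&& pairing N, #|N| == #|N0|, e \notin cover N & coindep E (e |: cover N)]]].
  have [||N1 /andP[pN1 iN1] wN1] := IH (E :\ e).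
  - by move: cEm; rewrite (cardsD1 e E) eE.
  - by apply: subset_trans sE; apply: subD1set.
  have sN1 : cover N1 \subset E :\ e by case/andP: iN1.
  have iN1' := coindep_card iN1.
  have cN1 := card_pairing pN1.
  have wle : w (E :\ e) <= w E by apply/weightS/subD1set.
  have eN1 : e \notin cover N1.
    by apply/negP=> /(subsetP sN1); rewrite !inE eqxx.
  have sN1E : cover N1 \subset E by apply: subset_trans sN1 (subD1set _ _).
  have [lt|ge] := ltnP (beta (E :\ e)) (beta E).
    have iN1e : coindep E (e |: cover N1).
      rewrite /coindep subUset sub1set eE sN1E cardsU1 eN1 /=.
      by rewrite -setDDl; move: iN1' lt; clear; lia.
    have lt1 : #|N1| < #|N0|.
      have := mx N1; rewrite /parity_set pN1 (coindepS _ iN1e) ?subsetUr // => /(_ isT).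
      rewrite leq_eqVlt => /orP[eqN|//].
      by have := he N1; rewrite pN1 eqN eN1 iN1e.
    exists N0 => //; have := betaD1 E e => b1.
    apply: leq_trans (leq_trans wN1 wle); rewrite leq_mul2l; apply/orP; right.
    by move: b1 lt1; clear; lia.
  have eqb : beta E = beta (E :\ e) by apply/eqP; rewrite eqn_leq ge betaS ?subD1set.
  exists N1; last by rewrite eqb; apply: leq_trans wle.
  rewrite /parity_set pN1 /coindep sN1E /=.
  have := beta_super (E :\: cover N1) (E :\ e).
  have -> : (E :\: cover N1) :|: (E :\ e) = E.
    apply/setP=> z; rewrite !inE; case: (z \in E); rewrite ?andbF //= !andbT.
    by have [->|] := eqVneq z e; rewrite ?eN1 ?orbT.
  have -> : (E :\: cover N1) :&: (E :\ e) = E :\ e :\: cover N1.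
    by apply/setP=> z; rewrite !inE; case: (z \in E); rewrite ?andbF //= !andbT.
  by move: iN1' ge; clear; lia.
rewrite negb_exists_in => /forall_inP avoid.
have avoid' h : h \in E -> exists N, [/\ pairing N, #|N| = #|N0|, h \notin cover N
    & coindep E (h |: cover N)].
  by move=> /avoid; rewrite negbK => /existsP[N /and4P[? /eqP ? ? ?]]; exists N.
have [b0|bpos] := posnP (beta E).
  by exists N0 => //; rewrite b0 muln0.
pose r := [rel a b | adjT a b && (b \in E)].
have [/forall_inP conn|] := boolP [forall e in E, [forall f in E, connect r e f]].
  have le := @gallai_bound E #|N0| mx avoid' N0 pN0 erefl.
  have {}le : beta E <= (2 * #|N0|).+1.
    apply: le => e f eE fE; have /forall_inP := conn e eE => /(_ f fE) /connectP[p pp ->].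
    by exists p.
  exists N0 => //; have := w_large sE bpos => wE.
  have {le} : 2 * (beta E - #|N0|) <= (beta E).+1.
    by rewrite mulnBr leq_subLR addnS; move: le; rewrite -ltnS; lia.
  move=> le; rewrite -(leq_pmul2l (isT : 0 < 2)) mulnCA.
  by apply: leq_trans wE; rewrite leq_mul2l le orbT.
rewrite negb_forall_in => /exists_inP[e eE]; rewrite negb_forall_in => /exists_inP[f fE ef].
pose A := [set x in E | connect r e x].
pose B := E :\: A.
have AE : A \subset E by apply/subsetP=> x; rewrite inE => /andP[].
have EAB : A :|: B = E by apply: setU_compl.
have dAB : [disjoint A & B] by apply: disjoint_compl.
have nadj x y : x \in A -> y \in B -> ~~ adjT x y.
  rewrite !inE => /andP[xE ex] /andP[+ yE]; rewrite yE /=; apply: contra => axy.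
  by apply: connect_trans ex (connect1 _); rewrite /= axy yE.
have eA : e \in A by rewrite inE eE connect0.
have fB : f \in B by rewrite !inE fE (negPf ef).
clearbody B; clearbody A; clear r ef.
have A_gt0 : 0 < #|A| by apply/card_gt0P; exists e.
have B_gt0 : 0 < #|B| by apply/card_gt0P; exists f.
have cAB : #|A| + #|B| = #|E|.
  by rewrite -EAB cardsU (disjoint_setI0 dAB) cards0 subn0.
have [||N1 /andP[pN1 iN1] wN1] := IH A.
- by clear -cEm cAB B_gt0; lia.
- exact: subset_trans sE.
have [||N2 /andP[pN2 iN2] wN2] := IH B.
- by clear -cEm cAB A_gt0; lia.
- by apply: subset_trans sE; rewrite -EAB subsetUr.
have [pE cN] := parity_setU dAB nadj pN1 iN1 pN2 iN2; rewrite EAB in pE.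
exists (N1 :|: N2) => //.
have bE : beta E <= beta A + beta B by rewrite -EAB; apply: beta_split.
have i1 := coindep_card iN1; have i2 := coindep_card iN2.
have wAB : w A + w B <= w E by rewrite -EAB; apply: w_add.
have c1 := card_pairing pN1; have c2 := card_pairing pN2.
apply: leq_trans (leq_trans (leq_add wN1 wN2) wAB); rewrite -mulnDr leq_mul2l cN.
have {i1}l1 : #|N1| <= beta A by move: i1 c1; clear; lia.
have {i2}l2 : #|N2| <= beta B by move: i2 c2; clear; lia.
by apply/orP; right; move: l1 l2 bE; clear; lia.
Qed.
End Matching.
End Nullity.

(** * The cycle space over a field of characteristic two *)

Section Boundary.
Local Open Scope ring_scope.
Variables (K : fieldType) (V : finType).
Hypothesis K2 : 2%N \in [pchar K].
Notation T := {set V}.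
Notation chain := {ffun T -> K^o}.
Implicit Types (A B D : {set T}) (z : chain).

Definition outside A z : chain := [ffun f => if f \in A then 0 else z f].
Definition boundary z : {ffun V -> K^o} := [ffun x => \sum_(f : T | x \in f) z f].

Fact outside_linear A : linear (outside A).
Proof.
move=> k u v; apply/ffunP=> f; rewrite !ffunE; case: ifP => _ //.
by rewrite scaler0 addr0.
Qed.
HB.instance Definition _ A :=
  GRing.isLinear.Build K chain chain _ (outside A) (outside_linear A).

Fact boundary_linear : linear boundary.
Proof.
move=> k u v; apply/ffunP=> x; rewrite !ffunE scaler_sumr -big_split /=.
by apply: eq_bigr => f _; rewrite !ffunE.
Qed.
HB.instance Definition _ :=
  GRing.isLinear.Build K chain {ffun V -> K^o} _ boundary boundary_linear.

Definition cycle_space A : {vspace chain} :=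
  (lker (linfun (outside A)) :&: lker (linfun boundary))%VS.

Definition nullity A : nat := \dim (cycle_space A).

Lemma cycle_spaceP A z :
  reflect ((forall f, f \notin A -> z f = 0) /\ (forall x, \sum_(f : T | x \in f) z f = 0))
          (z \in cycle_space A).
Proof.
rewrite memv_cap !memv_ker !lfunE /=; apply: (iffP andP) => -[h1 h2]; split.
- by move=> f /negPf fA; have /ffunP/(_ f) := eqP h1; rewrite !ffunE fA.
- by move=> x; have /ffunP/(_ x) := eqP h2; rewrite !ffunE.
- by apply/eqP/ffunP=> f; rewrite !ffunE; case: ifPn => // /h1.
- by apply/eqP/ffunP=> x; rewrite !ffunE.
Qed.

Definition supp z : {set T} := [set f | z f != 0].

Lemma supp_cycle_space A z : z \in cycle_space A -> supp z \subset A.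
Proof.
case/cycle_spaceP=> z1 _; apply/subsetP=> f; rewrite inE; apply: contraR => /z1->.
by rewrite eqxx.
Qed.

Lemma cycle_spaceS A B : A \subset B -> (cycle_space A <= cycle_space B)%VS.
Proof.
move=> /subsetP sAB; apply/subvP=> z /cycle_spaceP[zA zx]; apply/cycle_spaceP; split=> // f fB.
by apply: zA; apply: contra fB; apply: sAB.
Qed.

Lemma nullity0 : nullity set0 = 0%N.
Proof.
apply/eqP; rewrite dimv_eq0 -subv0; apply/subvP=> z /cycle_spaceP[z0 _].
by rewrite memv0; apply/eqP/ffunP=> f; rewrite z0 ?inE // ffunE.
Qed.

Lemma nullityS A B : A \subset B -> (nullity A <= nullity B)%N.
Proof. by move=> /cycle_spaceS/dimvS. Qed.

Lemma nullity_super A B : (nullity A + nullity B <= nullity (A :|: B) + nullity (A :&: B))%N.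
Proof.
rewrite /nullity -dimv_sum_cap leq_add // dimvS //.
  by rewrite subv_add !cycle_spaceS ?subsetUl ?subsetUr.
apply/subvP=> z; rewrite memv_cap => /andP[/cycle_spaceP[zA zx] /cycle_spaceP[zB _]].
by apply/cycle_spaceP; split=> // f; rewrite inE negb_and => /orP[/zA|/zB].
Qed.

(** The coordinate at [f] is one linear equation. *)
Lemma nullityD1 A f : (nullity A <= (nullity (A :\ f)).+1)%N.
Proof.
have [/subvP sub|/subvPn[z zA zf]] := boolP (cycle_space A <= cycle_space (A :\ f))%VS.
  by apply/leqW/dimvS/subvP.
suff sub : (cycle_space A <= <[z]> + cycle_space (A :\ f))%VS.
  apply: leq_trans (dimvS sub) _; apply: leq_trans (dimv_add_leqif _ _) _.
  by rewrite -add1n leq_add2r dim_vline; case: (_ != _).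
have /cycle_spaceP[z1 z2] := zA.
have zf0 : z f != 0.
  apply: contra zf => /eqP zf0; apply/cycle_spaceP; split=> // h.
  by rewrite !inE negb_and negbK => /orP[/eqP->//|/z1].
apply/subvP=> y /cycle_spaceP[y1 y2]; rewrite -(subrK ((y f / z f) *: z) y) addrC.
apply: memv_add; first by rewrite memvZ ?memv_line.
apply/cycle_spaceP; split=> [h|x]; last first.
  under eq_bigr do rewrite !ffunE; rewrite sumrB -scaler_sumr.
  by rewrite [X in _ *: X]z2 [X in X - _]y2 scaler0 subr0.
rewrite !ffunE !inE negb_and negbK => /orP[/eqP->|hA].
  by rewrite /GRing.scale /= divfK // subrr.
by rewrite (z1 h hA) (y1 h hA) scaler0 subr0.
Qed.

Lemma nullity_split A B : (forall f h : T, f \in A -> h \in B -> [disjoint f & h]) ->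
  (nullity (A :|: B) <= nullity A + nullity B)%N.
Proof.
move=> dAB; suff sub : (cycle_space (A :|: B) <= cycle_space A + cycle_space B)%VS.
  by apply: leq_trans (dimvS sub) (dimv_add_leqif _ _).
apply/subvP=> z /cycle_spaceP[z1 z2].
pose zA : chain := [ffun f => if f \in A then z f else 0].
have -> : z = zA + (z - zA) by rewrite addrC subrK.
have zA2 x : \sum_(f : T | x \in f) zA f = 0.
  have [/existsP[f /andP[fA xf]]|/existsPn nA] := boolP [exists f : T, (f \in A) && (x \in f)].
    apply: etrans (z2 x); apply: eq_bigr => h xh; rewrite ffunE; case: ifPn => // hA.
    rewrite z1 // inE (negPf hA) /=; apply/negP=> hB.
    by have /pred0P/(_ x) := dAB _ _ fA hB; rewrite /= xf xh.
  rewrite big1 // => f xf; rewrite ffunE; case: ifP => // fA.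
  by have := nA f; rewrite fA xf.
apply: memv_add; apply/cycle_spaceP; split=> //.
- by move=> f /negPf fA; rewrite ffunE fA.
- move=> f fB; rewrite !ffunE; case: ifPn => [fA|fA]; rewrite ?subrr //.
  by rewrite z1 ?subr0 // inE negb_or fA fB.
move=> x; rewrite (eq_bigr (fun f => z f - zA f)) => [|f _].
  by rewrite sumrB z2 zA2 subr0.
by rewrite ffunE [X in _ + X]ffunE.
Qed.

(** Adding up the boundary over the vertices of [X] counts every edge of the
    cut once and every other edge zero times or twice. *)
Lemma cycle_space_cut A z (X : {set V}) : z \in cycle_space A ->
  (forall f, f \in A -> #|f| = 2%N) ->
  \sum_(f in A | #|f :&: X| == 1%N) z f = 0.
Proof.
move=> /cycle_spaceP[z1 z2] cA.
have : \sum_(x in X) \sum_(f : T | x \in f) z f = 0 by rewrite big1.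
rewrite (exchange_big_dep predT) //= => sum0; apply: etrans sum0.
rewrite [RHS](bigID (fun f => (f \in A) && (#|f :&: X| == 1%N))) /=.
rewrite [X in _ = _ + X]big1 ?addr0.
  apply: eq_bigr => f /andP[fA /eqP c1].
  rewrite (eq_bigl (fun x => x \in f :&: X)) ?sumr_const ?c1 // => x.
  by rewrite inE andbC.
move=> f; rewrite negb_and => h.
rewrite (eq_bigl (fun x => x \in f :&: X)); last by move=> x; rewrite inE andbC.
rewrite sumr_const; case/orP: h => [/z1->|h]; first by rewrite mul0rn.
have [fA|/z1->] := boolP (f \in A); last by rewrite mul0rn.
have : (#|f :&: X| <= 2)%N by rewrite -(cA f fA) subset_leq_card ?subsetIl.
by case: #|_| h => [|[|[|]]] //= _ _; rewrite mulr2n addrr_pchar2.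
Qed.

End Boundary.

(** * Counting face boundaries *)

(** A combinatorial stand-in for the faces of a plane graph with edge set [A].
    Each edge has a left and a right side, and [m] says which sides belong to
    the same face: the faces are the classes of the equivalence relation
    generated by [m]. *)
Section FaceCount.
Local Open Scope ring_scope.
Variables (K : fieldType) (V J : finType).
Hypothesis K2 : 2%N \in [pchar K].
Notation T := {set V}.
Notation chain := {ffun T -> K^o}.
Variables (l r : T -> J) (m : rel J) (A : {set T}).
Definition face_inv (a : J -> K^o) := forall i j, m i j -> a i = a j.
Definition face_boundary (a : J -> K^o) : chain :=
  [ffun f => if f \in A then a (l f) + a (r f) else 0].
Hypothesis cycle_face : forall z : chain, z \in cycle_space K A ->
  exists2 a, face_inv a & forall f, f \in A -> z f = a (l f) + a (r f).
Hypothesis face_cycle : forall a, face_inv a -> face_boundary a \in cycle_space K A.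
Variables (P : {set T}) (g : nat).
Hypothesis girth : forall z : chain, z \in cycle_space K A -> z != 0 ->
  supp z \subset P /\ (g <= #|supp z|)%N.

Let m' := [rel i j | m i j || m j i].
Let m'_sym : connect_sym m'.
Proof. by apply: sym_connect_sym => i j /=; rewrite orbC. Qed.

Let rt := fingraph.root m'.
Let face i : chain := face_boundary (fun j => (rt j == i)%:R).

Lemma face_inv_root a j : face_inv a -> a (rt j) = a j.
Proof.
move=> ma; have /connectP[p] := connect_root m' j; rewrite -/(rt j) => + ->.
elim: p j => //= i p IH j /andP[/orP[/ma|/ma] e /IH ->] //.
Qed.

Lemma rt_inv i : face_inv (fun j => (rt j == i)%:R).
Proof.
move=> j k mjk; rewrite /rt (_ : fingraph.root m' j = fingraph.root m' k) //.
by apply/eqP; rewrite (root_connect m'_sym); apply: connect1; rewrite /= mjk.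
Qed.

Lemma sum_indicator (a : J -> K^o) j : \sum_i a i * (j == i)%:R = a j.
Proof.
rewrite (bigD1 j) //= eqxx mulr1 big1 ?addr0 // => i /negPf ij.
by rewrite eq_sym ij mulr0.
Qed.

Lemma face_decomposition a : face_inv a -> face_boundary a = \sum_i a i *: face i.
Proof.
move=> ma; apply/ffunP=> f; rewrite sum_ffunE !ffunE.
case: ifPn => fA; last first.
  by rewrite big1 // => i _; rewrite !ffunE (negPf fA) scaler0.
under eq_bigr => i _ do rewrite !ffunE fA scalerDr.
by rewrite big_split /= !sum_indicator !face_inv_root.
Qed.

(** Each edge has two sides, and the characteristic is two. *)
Lemma sum_faces : \sum_i face i = 0.
Proof.
have e : face_boundary (fun=> 1) = 0.
  by apply/ffunP=> f; rewrite !ffunE addrr_pchar2 //; case: ifP.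
apply: etrans e; rewrite face_decomposition //; apply: eq_bigr => i _; by rewrite scale1r.
Qed.

(** This is the only property of planar graphs that the theorem uses. The face
    boundaries span the cycle space and add up to zero, so at least
    [nullity + 1] of them are nonzero. Each of these has at least [g] edges,
    and an edge lies in at most two of them. *)
Theorem face_count : (0 < nullity K A)%N -> (g * (nullity K A).+1 <= 2 * #|A :&: P|)%N.
Proof.
move=> pos; pose N := [set i | face i != 0].
have face_Z i : face i \in cycle_space K A by apply/face_cycle/rt_inv.
have span_all z : z \in cycle_space K A -> exists2 a : J -> K^o, z = \sum_i a i *: face i & True.
  move=> zZ; have [a ma za] := cycle_face zZ; exists a => //.
  rewrite -face_decomposition //; apply/ffunP=> f; rewrite ffunE; case: ifPn => [|fA]; first exact: za.
  by case/cycle_spaceP: zZ => ->.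
have [i0 i0N] : exists i0, i0 \in N.
  apply/set0Pn; apply: contraL pos => /eqP N0; rewrite lt0n negbK dimv_eq0 -subv0.
  apply/subvP=> z /span_all[a -> _]; rewrite memv0 big1 // => i _.
  have : i \notin N by rewrite N0 inE.
  by rewrite inE negbK => /eqP->; rewrite scaler0.
have le1 : ((nullity K A).+1 <= #|N|)%N.
  rewrite (cardsD1 i0 N) i0N ltnS.
  suff sub : (cycle_space K A <= <<[seq face i | i <- enum (N :\ i0)]>>)%VS.
    by apply: leq_trans (dimvS sub) (leq_trans (dim_span _) _); rewrite size_map -cardE.
  apply/subvP=> z /span_all[a -> _].
  have -> : \sum_i a i *: face i = \sum_i (a i - a i0) *: face i.
    under [RHS]eq_bigr do rewrite scalerBl.
    by rewrite sumrB -scaler_sumr sum_faces scaler0 subr0.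
  rewrite (bigID (mem (N :\ i0))) /= [X in _ + X]big1 ?addr0.
    apply: memv_suml => i iN; apply/memvZ/memv_span/map_f; by rewrite mem_enum.
  move=> i; rewrite !inE negb_and !negbK => /orP[/eqP->|/eqP->]; last by rewrite scaler0.
  by rewrite subrr scale0r.
apply: leq_trans (leq_mul (leqnn g) le1) _.
rewrite mulnC -sum_nat_const.
have : (\sum_(i in N) g <= \sum_(i in N) #|supp (face i)|)%N.
  by apply: leq_sum => i; rewrite inE => iN; have [] := girth (face_Z i) iN.
move=> /leq_trans; apply.
have -> : (\sum_(i in N) #|supp (face i)| =
    \sum_(i in N) \sum_(f in A :&: P) (f \in supp (face i)))%N.
  apply: eq_bigr => i; rewrite inE => iN; rewrite -sum1_card.
  rewrite (eq_bigl (fun f => (f \in A :&: P) && (f \in supp (face i)))) ?big_mkcondr //= => f.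
  have [sP _] := girth (face_Z i) iN; have sA := supp_cycle_space (face_Z i).
  by have [fi|] := boolP (f \in supp _); rewrite ?andbF // inE (subsetP sA) // (subsetP sP).
rewrite exchange_big /= mulnC -sum_nat_const; apply: leq_sum => f _.
apply: leq_trans (_ : \sum_(i in [set rt (l f); rt (r f)]) 1 <= _)%N; last first.
  by rewrite sum1_card cards2; case: (_ != _).
rewrite [leqRHS]big_mkcond [leqLHS]big_mkcond /=; apply: leq_sum => i _.
case: ifP => // _; rewrite !inE ffunE ![i == _]eq_sym.
case: ifPn => // _; last by rewrite eqxx; case: ifP.
have [_|_] := eqVneq (rt (l f)) i; have [_|_] := eqVneq (rt (r f)) i; rewrite /= ?leq_b1 //.
by rewrite ?mulr0n addr0 eqxx.
Qed.
End FaceCount.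

(** * Grids: every cycle is the boundary of a set of faces *)

(** The face with index [(i, j)] is the unit square whose upper right corner is
    the lattice point [(i, j)]; with this choice the two faces beside an edge
    have indices obtained from those of its ends by adding one or nothing.
    The index of an edge is its left or lower end, and its first component
    tells whether it is horizontal. *)
Section Grid.
Local Open Scope ring_scope.
Variable n : nat.
Definition point : Type := 'I_n.+1 * 'I_n.+1.
HB.instance Definition _ := Finite.on point.
Definition grid_edge : Type := bool * ('I_n * 'I_n).
HB.instance Definition _ := Finite.on grid_edge.

Let w (i : 'I_n) : 'I_n.+1 := widen_ord (leqnSn n) i.
Let s (i : 'I_n) : 'I_n.+1 := lift ord0 i.

Definition src (e : grid_edge) : point := (w e.2.1, w e.2.2).
Definition tgt (e : grid_edge) : point :=
  if e.1 then (s e.2.1, w e.2.2) else (w e.2.1, s e.2.2).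
Definition lface (e : grid_edge) : point :=
  if e.1 then (s e.2.1, s e.2.2) else (w e.2.1, s e.2.2).
Definition rface (e : grid_edge) : point :=
  if e.1 then (s e.2.1, w e.2.2) else (s e.2.1, s e.2.2).

Definition grid_adj (p q : point) :=
  [exists e, ((src e == p) && (tgt e == q)) || ((src e == q) && (tgt e == p))].

Variable K : fieldType.
Hypothesis K2 : 2%N \in [pchar K].
Implicit Types (Y : grid_edge -> K^o).

Definition grid_boundary Y (p : point) : K^o :=
  \sum_(e | src e == p) Y e + \sum_(e | tgt e == p) Y e.

Lemma sum_grid_boundary Y (Q : pred point) :
  \sum_(p | Q p) grid_boundary Y p = \sum_(e | Q (src e)) Y e + \sum_(e | Q (tgt e)) Y e.
Proof.
rewrite big_split /=; congr (_ + _); rewrite [RHS](partition_big _ Q (fun e H => H)) /=.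
  by apply: eq_bigr => p Qp; apply: eq_bigl => e; case: eqP => [->|]; rewrite ?Qp ?andbF.
by apply: eq_bigr => p Qp; apply: eq_bigl => e; case: eqP => [->|]; rewrite ?Qp ?andbF.
Qed.

(** Chains as functions on pairs of natural numbers, so that sums along columns
    need no bounds. *)
Definition grid_val Y (d : bool) (i j : nat) : K^o :=
  if insub i is Some i' then if insub j is Some j' then Y (d, (i', j')) else 0 else 0.

Lemma grid_valE Y d (i j : 'I_n) : grid_val Y d i j = Y (d, (i, j)).
Proof. by rewrite /grid_val !valK. Qed.

Lemma sum_src Y (i j : 'I_n) :
  \sum_(e | src e == (w i, w j)) Y e = Y (true, (i, j)) + Y (false, (i, j)).
Proof.
rewrite (eq_bigl (fun e => e \in [set (true, (i, j)); (false, (i, j))])).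
  by rewrite big_setU1 ?inE //= big_set1.
case=> d [i' j']; rewrite !inE /src /= !xpair_eqE /= -!val_eqE /=.
by case: d; rewrite /= ?orbF.
Qed.

Lemma sum_tgt Y (i j : 'I_n) : \sum_(e | tgt e == (w i, w j)) Y e =
  (if val i is i'.+1 then grid_val Y true i' j else 0) +
  (if val j is j'.+1 then grid_val Y false i j' else 0).
Proof.
rewrite (bigID (fun e : grid_edge => e.1)) /=; congr (_ + _).
  case ei: (val i) => [|i'].
    rewrite big_pred0 // => -[d [i' j']] /=; case: d; rewrite ?andbF // andbT.
    by rewrite /tgt /= xpair_eqE -val_eqE /= ei.
  have li : (i' < n)%N by have := ltn_ord i; rewrite -[X in (X < _)%N]/(val i) ei; apply: ltnW.
  rewrite (_ : i' = Ordinal li :> nat) // grid_valE.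
  rewrite (big_pred1 (true, (Ordinal li, j))) // => -[d [a b]]; rewrite /tgt /=.
  case: d; rewrite /= ?andbF // andbT !xpair_eqE /= -!val_eqE /= ei.
  by rewrite /bump add1n eqSS.
case ej: (val j) => [|j'].
  rewrite big_pred0 // => -[d [i' j']] /=; case: d; rewrite ?andbF // andbT.
  by rewrite /tgt /= xpair_eqE -!val_eqE /= ej andbF.
have lj : (j' < n)%N by have := ltn_ord j; rewrite -[X in (X < _)%N]/(val j) ej; apply: ltnW.
rewrite (_ : j' = Ordinal lj :> nat) // grid_valE.
rewrite (big_pred1 (false, (i, Ordinal lj))) // => -[d [a b]]; rewrite /tgt /=.
case: d; rewrite /= ?andbF // andbT !xpair_eqE /= -!val_eqE /= ej.
by rewrite /bump add1n eqSS.
Qed.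

(** The winding number of the chain around a face: the chain is summed over the
    horizontal edges that a ray going down from the face crosses. *)
Definition potential Y (p : point) : K^o :=
  if val p.1 is i.+1 then \sum_(0 <= k < p.2) grid_val Y true i k else 0.

Lemma potential_succ Y (i : 'I_n) q :
  potential Y (s i, q) = \sum_(0 <= k < q) grid_val Y true i k.
Proof. by []. Qed.

(** Winding numbers on the two sides of an edge differ by the value at that
    edge. For a horizontal edge this is immediate; for a vertical one, walk up
    the column and use at each lattice point that the boundary vanishes. *)
Lemma potential_edge Y : (forall i j : 'I_n, grid_boundary Y (w i, w j) = 0) ->
  forall e, Y e = potential Y (lface e) + potential Y (rface e).
Proof.
move=> dY [[] [i j]]; rewrite /lface /rface /=.
  rewrite !potential_succ /= /bump leq0n add1n big_nat_recr //= [RHS]addrC addrA addrr_pchar2 //.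
  by rewrite add0r grid_valE.
have hdef i' (k : nat) : (k < n)%N -> 
    potential Y (w i', inord k.+1) = potential Y (w i', inord k) +
     (if val i' is i.+1 then grid_val Y true i k else 0).
  move=> kn; rewrite /potential /= !inordK ?ltnS //; last exact: ltnW.
  by case: (val i') => [|i0]; rewrite ?addr0 // big_nat_recr.
have hs (k : nat) : (k < n)%N -> 
    potential Y (s i, inord k.+1) = potential Y (s i, inord k) + grid_val Y true i k.
  move=> kn; rewrite !potential_succ !inordK ?ltnS //; last exact: ltnW.
  by rewrite big_nat_recr.
have -> : s j = inord j.+1.
  by apply: val_inj; rewrite /= inordK /bump ?add1n // ltnS.
rewrite -grid_valE; move: (ltn_ord j); elim: (val j) => [|k IH] kn.
  rewrite hdef // hs // potential_succ /potential /= inordK // big_geq //.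
  have := dY i (Ordinal kn); rewrite /grid_boundary sum_src sum_tgt /= addr0.
  rewrite -!grid_valE /= => d0.
  apply/eqP; rewrite -subr_eq0 oppr_pchar2 //; apply/eqP; rewrite -[RHS]d0.
  by case: (val i) => [|i']; rewrite ?big_geq //; ring.
rewrite hdef // hs // addrACA -IH ?(ltnW kn) //.
have := dY i (Ordinal kn); rewrite /grid_boundary sum_src sum_tgt /= -!grid_valE /= => d0.
apply/eqP; rewrite -subr_eq0 oppr_pchar2 //; apply/eqP; rewrite -[RHS]d0.
by case: (val i) => [|i']; ring.
Qed.

(** Each of the four faces around an inner lattice point lies between two
    consecutive edges at that point. *)
Lemma coboundary_boundary (a : point -> K^o) (i j : 'I_n) :
  (0 < i)%N -> (0 < j)%N ->
  grid_boundary (fun e => a (lface e) + a (rface e)) (w i, w j) = 0.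
Proof.
case: i => -[|i] //= li _; case: j => -[|j] //= lj _.
have li' := ltnW li; have lj' := ltnW lj.
rewrite /grid_boundary sum_src sum_tgt /=.
rewrite (grid_valE _ _ (Ordinal li') (Ordinal lj)) (grid_valE _ _ (Ordinal li) (Ordinal lj')).
rewrite /lface /rface /=.
have -> : s (Ordinal li') = w (Ordinal li) by apply: val_inj.
have -> : s (Ordinal lj') = w (Ordinal lj) by apply: val_inj.
set x1 := a _; set x2 := a _; set x3 := a _; set x4 := a _.
have -> : x1 + x2 + (x3 + x1) + (x3 + x4 + (x4 + x2)) =
  (x1 + x1) + (x2 + x2) + (x3 + x3) + (x4 + x4) by ring.
by rewrite !addrr_pchar2 // !addr0.
Qed.
End Grid.

(** * Minors of grids *)

Section GridMinor.
Local Open Scope ring_scope.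
Variables (n : nat) (V : finType).
Notation T := {set V}.
Variables (A : {set T}) (col : point n -> option V) (rho : T -> grid_edge n).

Definition class_adj : rel (point n) := fun p q =>
  [&& grid_adj p q, col p == col q & col p != None].

(** The coloured classes are the branch sets of a minor model in the grid, and
    [rho] selects for each edge of the minor a grid edge that represents it. *)
Record grid_minor : Prop := GridMinor {
  colored_inside : forall p, col p != None -> (0 < p.1 < n)%N && (0 < p.2 < n)%N;
  class_connected : forall p q, col p != None -> col p = col q -> connect class_adj p q;
  rho_ends : forall f, f \in A -> exists x y,
    [/\ x != y, f = [set x; y], col (src (rho f)) = Some x & col (tgt (rho f)) = Some y] }.

Hypothesis minor : grid_minor.
Variable K : fieldType.
Hypothesis K2 : 2%N \in [pchar K].
Notation chain := {ffun T -> K^o}.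
Implicit Type Y : grid_edge n -> K^o.

Definition inner (e : grid_edge n) := (col (src e) == col (tgt e)) && (col (src e) != None).
(** The grid edges that are contracted or survive in the minor; deleting another
    edge merges the faces on its two sides. *)
Definition kept e := inner e || (e \in rho @: A).
Definition merged : rel (point n) := fun i j =>
  [exists e, [&& ~~ kept e, lface e == i & rface e == j]].

Lemma rho_not_inner f : f \in A -> ~~ inner (rho f).
Proof.
move=> /(rho_ends minor)[x [y [xy _ cx cy]]]; rewrite /inner cx cy.
by apply: contra xy => /andP[/eqP[->]].
Qed.

Lemma rho_inj : {in A &, injective rho}.
Proof.
move=> f h /(rho_ends minor)[x [y [_ -> cx cy]]] /(rho_ends minor)[x' [y' [_ -> cx' cy']]] e.
by move: cx' cy'; rewrite -e cx cy => -[->] [->].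
Qed.

Lemma rho_sum (G : T -> K^o) (x : V) :
  \sum_(f in A | col (src (rho f)) == Some x) G f +
  \sum_(f in A | col (tgt (rho f)) == Some x) G f =
  \sum_(f in A | x \in f) G f.
Proof.
rewrite !big_mkcondr /= -big_split /=; apply: eq_bigr => f /(rho_ends minor).
case=> a [b [ab -> -> ->]]; rewrite !inE !(inj_eq (@Some_inj _)) !(eq_sym _ x).
have [xa|_] := eqVneq x a; have [xb|_] := eqVneq x b; rewrite ?addr0 ?add0r //.
by rewrite -xa xb eqxx in ab.
Qed.

(** The coboundary of [a] on the grid has boundary zero at inner lattice points
    and vanishes on the deleted edges. Adding up its boundary over a branch
    set counts the edges inside twice, and leaves the boundary in the minor at
    the contracted vertex. *)
Lemma minor_face_cycle (a : point n -> K^o) : face_inv merged a ->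
  face_boundary (fun f => lface (rho f)) (fun f => rface (rho f)) A a \in cycle_space K A.
Proof.
move=> ma; pose c e := a (lface e) + a (rface e).
have c0 e : ~~ kept e -> c e = 0.
  move=> ke; rewrite /c (ma (lface e) (rface e)) ?addrr_pchar2 //.
  by apply/existsP; exists e; rewrite ke !eqxx.
apply/cycle_spaceP; split=> [f fA|x]; first by rewrite ffunE (negPf fA).
transitivity (\sum_(f in A | x \in f) c (rho f)).
  rewrite [RHS]big_mkcond [LHS]big_mkcond /=; apply: eq_bigr => f _.
  by rewrite ffunE; case: (f \in A); case: (x \in f).
have sum0 : \sum_(p | col p == Some x) grid_boundary c p = 0.
  rewrite big1 // => -[p1 p2] /eqP cp; have := colored_inside minor (p := (p1, p2)).
  rewrite cp => /(_ isT) /andP[/= /andP[p10 p1n] /andP[p20 p2n]].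
  have := @coboundary_boundary n K K2 a (Ordinal p1n) (Ordinal p2n) p10 p20.
  by rewrite /c; congr (grid_boundary _ (_, _) = _); apply: val_inj.
rewrite sum_grid_boundary in sum0; rewrite -rho_sum; apply: etrans sum0.
have im Q : \sum_(f in A | Q (rho f)) c (rho f) = \sum_(e in rho @: A | Q e) c e.
  rewrite [RHS]big_mkcondr big_imset /=; last exact: rho_inj.
  by rewrite big_mkcondr.
rewrite (im (fun e => col (src e) == Some x)) (im (fun e => col (tgt e) == Some x)).
have spl (Q : pred (grid_edge n)) : \sum_(e | Q e) c e =
    \sum_(e in rho @: A | Q e) c e + \sum_(e | inner e && Q e) c e.
  rewrite (bigID (mem (rho @: A))) /=; congr (_ + _).
    by apply: eq_bigl => e; rewrite andbC.
  rewrite (bigID inner) /= [X in _ + X]big1 ?addr0.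
    apply: eq_bigl => e; rewrite andbC; case ie: (inner e) => //=.
    rewrite (_ : e \notin _) ?andbT //; apply: contraTN ie => /imsetP[f fA ->].
    exact: rho_not_inner.
  move=> e /andP[/andP[_ er] ie]; apply: c0; by rewrite /kept negb_or ie.
rewrite [in RHS]spl [X in _ = _ + X]spl.
have -> : \sum_(e | inner e && (col (tgt e) == Some x)) c e =
   \sum_(e | inner e && (col (src e) == Some x)) c e.
  by apply: eq_bigl => e; case ie: (inner e) => //=; case/andP: ie => /eqP->.
by rewrite addrACA addrr_pchar2 // addr0.
Qed.

(** The sum of the edges of a path has the ends of the path as boundary: in
    characteristic two the inner vertices cancel. *)
Lemma class_path p q x : col p = Some x -> connect class_adj p q ->
  exists2 Y : grid_edge n -> K^o, (forall e, Y e != 0 -> inner e) &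
    forall t, grid_boundary Y t = (t == p)%:R + (t == q)%:R.
Proof.
move=> cp /connectP[u]; elim: u p cp => [|v u IH] p cp /=.
  move=> _ ->; exists (fun=> 0) => [e|t]; first by rewrite eqxx.
  by rewrite addrr_pchar2 // /grid_boundary !big1 ?addr0.
case/andP=> /and3P[/existsP[e0 ends] /eqP cpv _] pu lu.
have [Y Yi dY] := IH v (etrans (esym cpv) cp) pu lu.
exists (fun e => Y e + (e == e0)%:R) => [e|t].
  have [->|_] := eqVneq e e0; last by rewrite addr0; apply: Yi.
  move=> _; rewrite /inner.
  by case/orP: ends => /andP[/eqP-> /eqP->]; rewrite -?cpv ?cpv -?cpv cp eqxx.
have -> : grid_boundary (fun e => Y e + (e == e0)%:R) t =
    grid_boundary Y t + ((t == src e0)%:R + (t == tgt e0)%:R).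
  rewrite /grid_boundary !big_split /= addrACA; congr (_ + _).
  rewrite ![\sum_(e | _ == t) _](bigID (pred1 e0)) /=.
  have h (F : grid_edge n -> point n) : \sum_(e | (F e == t) && (e == e0)) (e == e0)%:R +
     \sum_(e | (F e == t) && (e != e0)) (e == e0)%:R = (t == F e0)%:R :> K^o.
    rewrite [X in _ + X]big1 => [|e /andP[_ /negPf->] //]; rewrite addr0 eq_sym.
    have [Ft|/negPf Ft] := eqVneq (F e0) t.
      rewrite (big_pred1 e0) ?eqxx // => e.
      by have [->|/negPf ne] := eqVneq e e0; rewrite /= ?Ft ?eqxx ?ne ?andbF.
    by rewrite big_pred0 // => e; have [->|] := eqVneq e e0; rewrite ?Ft ?andbF.
  by congr (_ + _); apply: h.
rewrite dY; set a := (t == v)%:R; set b := (t == q)%:R; set d := (t == p)%:R.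
have -> : (t == src e0)%:R + (t == tgt e0)%:R = d + a :> K^o.
  by case/orP: ends => /andP[/eqP-> /eqP->]; rewrite // addrC.
by rewrite addrC addrA -(addrA d) addrr_pchar2 // addr0.
Qed.

Lemma grid_boundary_lin (I : finType) (Q : pred I) (k : I -> K) (W : I -> grid_edge n -> K^o) Y t :
  grid_boundary (fun e => Y e + \sum_(i | Q i) k i * W i e) t =
  grid_boundary Y t + \sum_(i | Q i) k i * grid_boundary (W i) t.
Proof.
rewrite /grid_boundary !big_split /= addrACA; congr (_ + _).
rewrite exchange_big [X in _ + X]exchange_big -big_split /=; apply: eq_bigr => i _.
by rewrite mulrDr !mulr_sumr.
Qed.

(** An element [z] of the cycle space of the minor lifts to the grid. Place it
    on the representing edges; where the resulting chain has a nonzero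
    boundary, cancel it by multiples of paths inside the branch set towards a
    base point. What is collected at the base point is the boundary of [z] in
    the minor, which is zero. The winding numbers of the lift are the required
    labels, and agree across the edges where the lift vanishes. *)
Lemma minor_cycle_face (z : chain) : z \in cycle_space K A ->
  exists2 a, face_inv merged a &
    forall f, f \in A -> z f = a (lface (rho f)) + a (rface (rho f)).
Proof.
move=> /cycle_spaceP[z1 z2].
pose Y0 e : K^o := \sum_(f in A | rho f == e) z f.
have Y0s (Q : pred (grid_edge n)) : \sum_(e | Q e) Y0 e = \sum_(f in A | Q (rho f)) z f.
  rewrite [RHS](partition_big rho Q) => [|f /andP[] //]; apply: eq_bigr => e Qe.
  by apply: eq_bigl => f; case: eqP => [->|]; rewrite ?Qe ?andbT ?andbF.
have dY0 x : \sum_(p | col p == Some x) grid_boundary Y0 p = 0.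
  rewrite sum_grid_boundary !Y0s rho_sum -[RHS](z2 x).
  rewrite [RHS](bigID (mem A)) /= [X in _ = _ + X]big1 ?addr0.
    by apply: eq_bigl => f; rewrite andbC.
  by move=> f /andP[_ /z1].
(* one base point for each branch set *)
pose base p := odflt p [pick q | col q == col p].
have col_base p : col (base p) = col p by rewrite /base; case: pickP => //= q /eqP.
have base_eq p q : col p = col q -> base p = base q.
  move=> e; rewrite /base (eq_pick (Q := fun t => col t == col q)) ?e //.
  by case: pickP => // /(_ q); rewrite eqxx.
have hW p : exists W : grid_edge n -> K^o, (forall e, W e != 0 -> inner e) /\
   (col p != None -> forall t, grid_boundary W t = (t == p)%:R + (t == base p)%:R).
  case cp: (col p) => [x|]; last by exists (fun=> 0); split=> // e; rewrite eqxx.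
  have [|W W1 W2] := class_path (q := base p) cp; last by exists W.
  by apply: (class_connected minor); rewrite ?cp // col_base.
have [W hW2] := fin_all_exists hW.
have Y0u p : col p = None -> grid_boundary Y0 p = 0.
  move=> cp; rewrite /grid_boundary !Y0s !big1 ?addr0 // => f /andP[/(rho_ends minor)].
    by case=> x [y [_ _ _ ct]] /eqP e; rewrite e cp in ct.
  by case=> x [y [_ _ cs _]] /eqP e; rewrite e cp in cs.
pose Y e := Y0 e + \sum_p grid_boundary Y0 p * W p e.
have dY t : grid_boundary Y t = 0.
  rewrite /Y grid_boundary_lin.
  have -> : \sum_p grid_boundary Y0 p * grid_boundary (W p) t =
     \sum_p grid_boundary Y0 p * (t == p)%:R + \sum_p grid_boundary Y0 p * (t == base p)%:R.
    rewrite -big_split /=; apply: eq_bigr => p _; rewrite -mulrDr.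
    case cp: (col p) => [x|]; last by rewrite Y0u // !mul0r.
    by have [_ ->] := hW2 p; rewrite ?cp.
  have -> : \sum_p grid_boundary Y0 p * (t == p)%:R = grid_boundary Y0 t.
    rewrite (bigD1 t) //= eqxx mulr1 big1 ?addr0 // => p /negPf tp.
    by rewrite eq_sym tp mulr0.
  rewrite addrA addrr_pchar2 // add0r.
  case ct: (col t) => [x|]; last first.
    rewrite big1 // => p _; have [tp|_] := eqVneq t (base p); last by rewrite mulr0.
    by rewrite Y0u ?mul0r // -col_base -tp.
  have [bt|bt] := eqVneq t (base t); last first.
    rewrite big1 // => p _; have [tp|_] := eqVneq t (base p); last by rewrite mulr0.
    case/eqP: bt; rewrite [LHS]tp; apply: base_eq.
    by rewrite tp col_base.
  rewrite -[RHS](dY0 x) [RHS]big_mkcond /=; apply: eq_bigr => p _.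
  have [tp|tp] := eqVneq t (base p).
    by rewrite -col_base -tp ct eqxx mulr1.
  case: ifPn => [/eqP cp|_]; last by rewrite mulr0.
  by case/eqP: tp; rewrite [LHS]bt; apply: base_eq; rewrite cp.
have Yk e : ~~ kept e -> Y e = 0.
  rewrite /kept negb_or => /andP[ie re]; rewrite /Y /Y0 !big1 ?addr0 //.
    move=> p _; have [-> |nz] := eqVneq (W p e) 0; first by rewrite mulr0.
    by have [/(_ e nz)] := hW2 p; rewrite (negPf ie).
  by move=> f /andP[fA /eqP fe]; case/negP: re; rewrite -fe imset_f.
have dYp (i j : 'I_n) := dY (widen_ord (leqnSn n) i, widen_ord (leqnSn n) j).
have pot := potential_edge K2 dYp.
exists (potential Y) => [i j /existsP[e /and3P[ke /eqP<- /eqP<-]]|f fA].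
  by apply/eqP; rewrite -subr_eq0 oppr_pchar2 // -pot Yk.
rewrite -pot /Y [X in _ = _ + X]big1 ?addr0.
  rewrite /Y0 (big_pred1 f) // => h /=; apply/andP/eqP => [[hA /eqP]|->].
    exact: rho_inj.
  by [].
move=> p _; have [-> |nz] := eqVneq (W p (rho f)) 0; first by rewrite mulr0.
by have [/(_ _ nz)] := hW2 p; rewrite (negPf (rho_not_inner fA)).
Qed.
End GridMinor.

(** * Cycles, bridges and feedback vertex sets *)

Section Cycles.
Variable V : finType.
Implicit Types (c : seq V).

Definition cycle_edges c : seq {set V} := [seq [set x; next c x] | x <- c].

Lemma next_next_neq c x : uniq c -> 2 < size c -> x \in c -> next c (next c x) != x.
Proof.
move=> uc sc xc; case/rot_to: (xc) => i s es.
have ur : uniq (rot i c) by rewrite rot_uniq.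
rewrite -!(next_rot i uc); move: ur sc; rewrite -(size_rot i) es.
case: s {es} => [|y [|w s]] //= /and3P[]; rewrite !inE !negb_or => /and3P[xy xw xs] /andP[yw ys] _ _.
by rewrite !eqxx (eq_sym y x) (negPf xy) eq_sym.
Qed.

Lemma next_neq c x : uniq c -> 1 < size c -> x \in c -> next c x != x.
Proof.
move=> uc sc xc; case/rot_to: (xc) => i s es.
have ur : uniq (rot i c) by rewrite rot_uniq.
rewrite -!(next_rot i uc); move: ur sc; rewrite -(size_rot i) es.
case: s {es} => [|y s] //= /and3P[]; rewrite !inE !negb_or => /andP[xy _] _ _ _.
by rewrite eqxx eq_sym.
Qed.

Lemma uniq_cycle_edges c : uniq c -> 2 < size c -> uniq (cycle_edges c).
Proof.
move=> uc sc; rewrite map_inj_in_uniq // => x y xc yc /setP e.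
have := e x; rewrite !inE eqxx /= => /esym/orP[/eqP//|/eqP xny].
have := e y; rewrite !inE eqxx /= => /orP[/eqP//|/eqP ynx].
by have := next_next_neq uc sc xc; rewrite -ynx -xny eqxx.
Qed.
End Cycles.

Section Graph.
Variables (K : fieldType) (G : sgraph).
Hypothesis K2 : (2%N \in [pchar K])%R.
Notation T := {set G}.
Notation chain := {ffun T -> K^o}%R.
Implicit Types (z : chain) (c : seq G).

Lemma edgesP (f : T) : reflect (exists x y, adj x y /\ f = [set x; y]) (f \in edges G).
Proof.
rewrite inE; apply: (iffP existsP) => [[x /existsP[y /andP[xy /eqP->]]]|[x [y [xy ->]]]].
  by exists x, y.
by exists x; apply/existsP; exists y; rewrite xy eqxx.
Qed.

Lemma adj_neq (x y : G) : adj x y -> x != y.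
Proof. by apply: contraTneq => ->; rewrite adj_irr. Qed.

Lemma edge_adj (x y : G) : [set x; y] \in edges G -> adj x y.
Proof.
case/edgesP=> a [b [ab e]]; have := adj_neq ab => nab.
move/setP: e => e; have := e a; have := e b; have := e x; have := e y.
rewrite !inE !eqxx !orbT /= => /esym ya /esym xa /orP[]/eqP bb /orP[]/eqP aa.
- by rewrite aa bb eqxx in nab.
- by rewrite -aa -bb adj_sym.
- by rewrite -aa -bb.
- by rewrite aa bb eqxx in nab.
Qed.

Lemma card_edge (f : T) : f \in edges G -> #|f| = 2.
Proof. by case/edgesP=> x [y [/adj_neq xy ->]]; rewrite cards2 xy. Qed.

Lemma edge_at (f : T) x : f \in edges G -> x \in f -> exists2 y, adj x y & f = [set x; y].
Proof.
case/edgesP=> a [b [ab ->]]; rewrite !inE => /orP[]/eqP->; first by exists b.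
by exists a; rewrite 1?adj_sym // setUC.
Qed.

Lemma cycle_space_degree z f x : z \in cycle_space K (edges G) -> f \in supp z -> x \in f ->
  exists h, [/\ h \in supp z, h != f & x \in h].
Proof.
move=> /cycle_spaceP[_ z2]; rewrite inE => zf xf.
suff /existsP[h /and3P[? ? ?]] : [exists h : T, [&& h \in supp z, h != f & x \in h]] by exists h.
apply: contraR zf => /existsPn hz; have := z2 x; rewrite (bigD1 f) //= big1 ?addr0 => [->//|h /andP[xh hf]].
by have := hz h; rewrite inE hf xh !andbT negbK => /eqP.
Qed.

Definition supp_adj z : rel G := fun x y => [set x; y] \in supp z.

(** In the support of a cycle-space element no vertex has degree one, so a path
    can be prolonged at its start until it closes up. *)
Lemma supp_cycle_from z (x y : G) (p : seq G) : z \in cycle_space K (edges G) ->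
  uniq [:: x, y & p] -> path (supp_adj z) x (y :: p) ->
  exists c, [/\ uniq c, cycle (supp_adj z) c & 2 < size c].
Proof.
move=> zZ; have sE := supp_cycle_space zZ.
have sym : symmetric (supp_adj z) by move=> a b; rewrite /supp_adj setUC.
have [m] := ubnP (#|G| - size p); elim: m x y p => // m IH x y p lem up pp.
have sz : size [:: x, y & p] <= #|G| by rewrite -(card_uniqP up) max_card.
have [xyz _] := andP pp.
have [w [ww wy xw]] := cycle_space_degree zZ xyz (set21 x y).
have [t axt et] := edge_at (subsetP sE _ ww) xw.
have tx : t != x by rewrite eq_sym adj_neq.
have ty : t != y by apply: contraNneq wy => <-; rewrite et.
have [tp|tp] := boolP (t \in p); last first.
  apply: (IH t x (y :: p)) => /=; first by
      move: lem; rewrite ltnS subnS; apply: leq_trans; rewrite ltn_predL subn_gt0 ltnW.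
    by move: up; rewrite /= !inE !negb_or tx ty tp.
  by rewrite sym {1}/supp_adj -et ww; exact: pp.
case/splitPr: p / tp up pp {sz lem} => p1 p2 up pp.
exists [:: x, y & rcons p1 t]; split; last by rewrite /= size_rcons.
  move: up; rewrite -cat_rcons -!cat_cons cat_uniq; by case/andP.
move: pp; rewrite -cat_rcons -cat_cons cat_path => /andP[pp _].
rewrite /= !rcons_path; move: pp; rewrite /= rcons_path => /and3P[-> -> ->] /=.
by rewrite last_rcons sym /supp_adj -et ww.
Qed.

Lemma supp_cycle z : z \in cycle_space K (edges G) -> z != 0%R ->
  exists c, [/\ uniq c, cycle (supp_adj z) c & 2 < size c].
Proof.
move=> zZ nz; have [f fz] : exists f, f \in supp z.
  apply/set0Pn; apply: contra nz => /eqP s0; apply/eqP/ffunP=> f; rewrite ffunE.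
  by apply/eqP; move/setP/(_ f): s0; rewrite !inE => /negbFE.
have /edgesP[x [y [xy ef]]] := subsetP (supp_cycle_space zZ) _ fz.
apply: (@supp_cycle_from z x y [::] zZ); first by rewrite /= inE adj_neq.
by rewrite /= /supp_adj -ef fz.
Qed.

Lemma supp_girth g z : girth_at_least G g -> z \in cycle_space K (edges G) -> z != 0%R ->
  g <= #|supp z|.
Proof.
move=> gG zZ nz; have [c [uc cc sc]] := supp_cycle zZ nz.
have sE := supp_cycle_space zZ.
have gc : graph_cycle c.
  rewrite /graph_cycle sc andbT /ucycleb uc andbT; move: cc; apply: sub_cycle => x y xy.
  exact/edge_adj/(subsetP sE).
apply: leq_trans (gG c gc) _; rewrite -(size_map (fun x => [set x; next c x]) c).
rewrite -(card_uniqP (uniq_cycle_edges uc sc)); apply/subset_leq_card/subsetP=> f /mapP[x xc ->].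
exact: (next_cycle cc xc).
Qed.

(** A bridge is a cut with one edge, and the values of a cycle-space element
    on a cut add up to zero. *)
Lemma supp_nonbridge z : z \in cycle_space K (edges G) -> supp z \subset edges G :\: bridges G.
Proof.
move=> zZ; apply/subsetP=> f fz; rewrite inE (subsetP (supp_cycle_space zZ)) // andbT.
apply/negP; rewrite inE => /andP[_ /existsP[X /eqP eX]].
have := cycle_space_cut K2 X zZ card_edge.
rewrite (eq_bigl (pred1 f)) ?big_pred1_eq => [zf|h].
  by move: fz; rewrite inE [z f]zf eqxx.
by move/setP/(_ h): eX; rewrite !inE => <-.
Qed.

(** The characteristic function of the edge set of a cycle. *)
Definition cycle_chain c : chain := [ffun f => (f \in cycle_edges c)%:R]%R.

Lemma cycle_chain_space c (A : {set T}) : uniq c -> 2 < size c -> {subset cycle_edges c <= A} ->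
  cycle_chain c \in cycle_space K A.
Proof.
move=> uc sc sA; apply/cycle_spaceP; split=> [f fA|x].
  by rewrite ffunE; have [/sA|//] := boolP (f \in cycle_edges c); rewrite (negPf fA).
have uce := uniq_cycle_edges uc sc.
have -> : (\sum_(f : T | x \in f) cycle_chain c f = \sum_(y <- c) ((x == y)%:R + (x == next c y)%:R))%R.
  transitivity (\sum_(f in cycle_edges c) (x \in f)%:R : K^o)%R.
    rewrite [LHS]big_mkcond [RHS]big_mkcond /=; apply: eq_bigr => f _; rewrite ffunE.
    by case: (x \in f); case: (f \in _).
  rewrite -(big_uniq _ uce) /= big_map [LHS]big_seq [RHS]big_seq; apply: eq_bigr => y yc.
  rewrite !inE; have := next_neq uc (ltnW sc) yc.
  have [->|_] := eqVneq x y; last by rewrite add0r.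
  by rewrite eq_sym => /negPf->; rewrite addr0.
rewrite big_split /=.
have cnt a : (\sum_(y <- c) (y == a)%:R = (a \in c)%:R :> K^o)%R.
  rewrite -natr_sum -count_uniq_mem // -sum1_count; congr (_%:R)%R.
  rewrite [RHS]big_mkcond; by apply: eq_bigr => y _ /=; case: eqP.
under eq_bigr do rewrite eq_sym.
under [X in (_ + X)%R]eq_bigr => y _ do rewrite eq_sym (can2_eq (prev_next uc) (next_prev uc)).
by rewrite !cnt mem_prev addrr_pchar2.
Qed.

Lemma hitting_set (I : finType) (N : {set I}) (P : I -> pred G) :
  (forall i, i \in N -> exists x, P i x) ->
  exists2 S : {set G}, #|S| <= #|N| & forall i, i \in N -> exists2 x, x \in S & P i x.
Proof.
move=> hP; pose F i := [pick x | P i x].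
exists [set x | Some x \in F @: N] => [|i iN].
  apply: leq_trans (leq_imset_card F N); rewrite -(card_imset _ (@Some_inj _)).
  by apply/subset_leq_card/subsetP=> _ /imsetP[x xS ->]; rewrite inE in xS.
case eF: (F i) => [x|].
  exists x; first by rewrite inE -eF imset_f.
  by move: eF; rewrite /F; case: pickP => // y Py [<-].
move: eF; rewrite /F; case: pickP => // nP _.
by have [x] := hP i iN; rewrite nP.
Qed.

Lemma feedback_of_edges (D : {set T}) (S : {set G}) :
  nullity K (edges G :\: D) = 0 -> (forall f, f \in D -> exists2 x, x \in S & x \in f) ->
  feedback_vertex_set S.
Proof.
move=> n0 hS c; apply/negP=> /andP[/andP[cc uc] sc].
pose c' : seq G := map val c.
have uc' : uniq c' by rewrite map_inj_uniq //; apply: val_inj.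
have sc' : 2 < size c' by rewrite size_map.
have cc' : cycle (@adj G) c' by rewrite cycle_map; apply: sub_cycle cc => x y.
have cS x : x \in c' -> x \notin S by case/mapP=> -[y yS] _ ->.
have : cycle_chain c' \in cycle_space K (edges G :\: D).
  apply: cycle_chain_space => // f /mapP[x xc ->]; rewrite inE; apply/andP; split.
    apply/negP=> /hS[y yS]; rewrite !inE => /orP[]/eqP ey; move: yS; rewrite ey.
      by apply/negP/cS.
    by apply/negP/cS; rewrite mem_next.
  apply/edgesP; exists x, (next c' x); split=> //; exact: (next_cycle cc' xc).
have -> : cycle_space K (edges G :\: D) = 0%VS by apply/eqP; rewrite -dimv_eq0; apply/eqP.
rewrite memv0 => /eqP/ffunP; clearbody c'.
move: uc' sc'; clear; case: c' => [//|x c'] _ _ /(_ [set x; next (x :: c') x]).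
rewrite !ffunE mem_head; apply/eqP; exact: oner_neq0.
Qed.

(** Extend the edges of an optimal pairing [N] to a set [D] of [nullity] edges
    whose removal destroys all cycles. A common end of each pair of [N] and an
    end of each remaining edge of [D] form a feedback vertex set with
    [nullity - #|N|] elements. *)
Theorem fvs_bound g n (col : point n -> option G) rho :
  girth_at_least G g -> grid_minor (edges G) col rho ->
  g * fvs G <= #|edges G| - #|bridges G|.
Proof.
move=> gG minor.
pose P := edges G :\: bridges G.
pose adjT : rel T := fun f h => ~~ [disjoint f & h].
have adjT_sym : symmetric adjT by move=> f h; rewrite /adjT disjoint_sym.
have sup (A : {set T}) z : A \subset edges G -> z \in cycle_space K A -> z != 0%R -> supp z \subset P /\ g <= #|supp z|.
  move=> sA zA nz; have zZ := subvP (cycle_spaceS K sA) _ zA.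
  by split; [apply: supp_nonbridge | apply: supp_girth].
have wP (A : {set T}) : A \subset edges G -> 0 < nullity K A -> g * (nullity K A).+1 <= 2 * #|A :&: P|.
  move=> sA; have mA : grid_minor A col rho.
    by case: minor => m1 m2 m3; split=> // f /(subsetP sA); apply: m3.
  apply: (@face_count K G _ K2 _ _ (merged A col rho) A) => [z||z].
  - exact: minor_cycle_face.
  - exact: minor_face_cycle.
  - exact: sup.
have [|||N /andP[pN iN] bN] := @parity_bound _ (@nullity K G) (@nullityD1 K G)
  (@nullity_super K G) (nullity0 K G) (@nullityS K G) adjT adjT_sym _ (edges G) g (fun A => #|A :&: P|) _ wP (edges G).
- move=> A B nAB; apply: nullity_split => f h fA hB; have := nAB f h fA hB.
  by rewrite negbK.
- move=> A B dAB; rewrite setIUl cardsU (_ : (A :&: P) :&: (B :&: P) = set0) ?cards0 ?subn0 //.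
  apply/setP=> f; rewrite !inE; have /pred0P/(_ f)/= := dAB.
  by case: (f \in A); case: (f \in B); rewrite //= ?andbF.
- exact: subxx.
have [D [sND iD cD]] := coindep_basis (@nullityD1 K G) (@nullity_super K G) (nullity0 K G) iN.
have nD : nullity K (edges G :\: D) = 0.
  by have := coindep_card (@nullityD1 K G) iD; rewrite cD; lia.
have [|S1 cS1 hS1] := @hitting_set _ N (fun B x => [forall f in B, x \in f]).
  move=> B /(pairingP pN) /existsP[f /existsP[h /and3P[_ afh /eqP->]]].
  have [x /andP[xf xh]] := pred0Pn afh; exists x; apply/forall_inP=> k.
  by rewrite !inE => /orP[]/eqP->.
have [|S2 cS2 hS2] := @hitting_set _ (D :\: cover N) (fun f x => x \in f).
  move=> f /setDP[fD _]; have /subsetP sD := (andP iD).1.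
  by apply/card_gt0P; rewrite card_edge // sD.
have [_ minS] := fvsP G.
have le : fvs G <= nullity K (edges G) - #|N|.
  apply: leq_trans (minS (S1 :|: S2) _) _.
    apply: (feedback_of_edges nD) => f fD.
    have [/bigcupP[B BN fB]|fN] := boolP (f \in cover N).
      have [x xS /forall_inP h] := hS1 B BN.
      by exists x; [rewrite inE xS | apply: h].
    have [|x xS xf] := hS2 f; first by rewrite inE fN.
    by exists x; rewrite ?inE ?xS ?orbT.
  apply: leq_trans (leq_card_setU _ _) _; apply: leq_trans (leq_add cS1 cS2) _.
  have := cardsID (cover N) D; rewrite (setIidPr sND) (card_pairing pN) cD => <-.
  by rewrite mul2n -addnn -addnA addKn.
apply: leq_trans (leq_trans (leq_mul (leqnn g) le) bN) _.
rewrite (setIidPr _) ?cardsDS ?subsetDl //.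
by apply/subsetP=> f; rewrite inE => /andP[].
Qed.
End Graph.

(** * From disjoint discs and tubes of lattice points to a minor *)

Lemma grid_adj_sym n : symmetric (@grid_adj n).
Proof. by move=> p q; apply: eq_existsb => e; rewrite orbC. Qed.

Definition grid_within n (D : {set point n}) : rel (point n) :=
  fun p q => [&& grid_adj p q, p \in D & q \in D].

Section PixelModel.
Variables (G : sgraph) (n : nat).
Notation T := {set G}.
Variables (disc : G -> {set point n}) (tube : T -> {set point n}).

(** What remains of a plane drawing on a fine lattice: the lattice points close
    to a vertex form its disc, those close to an edge its tube. Tubes may
    overlap, but only inside discs. *)
Record pixel_model : Prop := PixelModel {
  disc_inside : forall x p, p \in disc x -> (0 < p.1 < n) && (0 < p.2 < n);
  tube_inside : forall f p, f \in edges G -> p \in tube f -> (0 < p.1 < n) && (0 < p.2 < n);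
  disc_connected : forall x p q, p \in disc x -> q \in disc x ->
    connect (grid_within (disc x)) p q;
  disc_disjoint : forall x y p, p \in disc x -> p \in disc y -> x = y;
  disc_tube : forall f x p, f \in edges G -> p \in tube f -> p \in disc x -> x \in f;
  tube_tube : forall f h p, f \in edges G -> h \in edges G -> f != h ->
    p \in tube f -> p \in tube h -> exists x, p \in disc x;
  tube_joins : forall f, f \in edges G -> exists x y p q,
    [/\ f = [set x; y], p \in disc x :&: tube f, q \in disc y :&: tube f &
      connect (grid_within (tube f)) p q] }.

Hypothesis n_gt0 : 0 < n.
Hypothesis model : pixel_model.

Section Branch.
Variables (s t : T -> G).
Hypothesis st : forall f, f \in edges G -> exists p q,
    [/\ f = [set s f; t f], p \in disc (s f) :&: tube f, q \in disc (t f) :&: tube f &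
      connect (grid_within (tube f)) p q].

(** The part of the tube of [f] that is added to the disc of its first end [s f]:
    whatever can be reached from that disc without entering the disc of
    [t f]. It need not be the whole tube, which may fall into several pieces
    once the second disc is removed. *)
Definition reach f : {set point n} :=
  [set q | [exists p in disc (s f) :&: tube f, connect (grid_within (tube f :\: disc (t f))) p q]
     && (q \in tube f :\: disc (t f))].

Definition branch x : {set point n} :=
  disc x :|: \bigcup_(f in edges G | s f == x) reach f.

Lemma branchP x p : reflect (p \in disc x \/ exists f, [/\ f \in edges G, s f = x & p \in reach f])
  (p \in branch x).
Proof.
rewrite inE; apply: (iffP orP) => -[]; try by left.
  by case/bigcupP=> f /andP[fE /eqP sf] pf; right; exists f.
by case=> f [fE sf pf]; right; apply/bigcupP; exists f; rewrite ?fE ?sf ?eqxx.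
Qed.

Lemma reach_disc f x p : f \in edges G -> p \in reach f -> p \in disc x -> x = s f.
Proof.
move=> fE; rewrite inE => /andP[_ /setDP[pf pt]] px.
have [_ [_ [ef _ _ _]]] := st fE; have := disc_tube model fE pf px; rewrite {1}ef.
by rewrite !inE => /orP[]/eqP // xt; rewrite -xt px in pt.
Qed.

Lemma branch_disjoint x y p : p \in branch x -> p \in branch y -> x = y.
Proof.
case/branchP=> [px|[f [fE sf pf]]] /branchP[py|[h [hE sh ph]]].
- exact: disc_disjoint px py.
- by rewrite -sh; apply: reach_disc px.
- by rewrite -sf; apply/esym/(reach_disc _ pf).
have [fh|fh] := eqVneq f h; first by rewrite -sf -sh fh.
have [|||//||z pz] := tube_tube model (f := f) (h := h) (p := p) => //.
- by move: pf; rewrite inE => /andP[_ /setDP[]].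
- by move: ph; rewrite inE => /andP[_ /setDP[]].
by rewrite -sf -sh -(reach_disc fE pf pz) -(reach_disc hE ph pz).
Qed.

Definition colour p : option G := [pick x | p \in branch x].

Lemma colourE p x : p \in branch x -> colour p = Some x.
Proof.
move=> px; rewrite /colour; case: pickP => [y py|/(_ x)]; last by rewrite px.
by rewrite (branch_disjoint px py).
Qed.

Lemma colourP p x : colour p = Some x -> p \in branch x.
Proof. by rewrite /colour; case: pickP => // y py [<-]. Qed.

Lemma class_adjE x p q : grid_adj p q -> p \in branch x -> q \in branch x ->
  class_adj colour p q.
Proof. by move=> pq px qx; rewrite /class_adj pq !(@colourE _ x) ?eqxx. Qed.

Lemma class_adj_sym : symmetric (class_adj colour).
Proof.
move=> p q; rewrite /class_adj grid_adj_sym eq_sym.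
by case: eqP => [->|]; rewrite ?andbF.
Qed.

Lemma disc_branch_connected x p q : p \in disc x -> q \in disc x ->
  connect (class_adj colour) p q.
Proof.
move=> px qx; apply: connect_sub (disc_connected model px qx) => a b /and3P[ab ax bx].
by apply/connect1/(class_adjE (x := x)) => //; apply/branchP; left.
Qed.

Lemma reach_connected f q : f \in edges G -> q \in reach f ->
  exists2 p, p \in disc (s f) & connect (class_adj colour) p q.
Proof.
move=> fE; rewrite inE => /andP[/exists_inP[p pst /connectP[u pu ->]] _].
exists p; first by case/setIP: pst.
have pb : p \in branch (s f) by apply/branchP; left; case/setIP: pst.
have : exists2 p0, p0 \in disc (s f) :&: tube f &
   connect (grid_within (tube f :\: disc (t f))) p0 p by exists p.
elim: u p {pst} pu pb => [|b u IH] p /=; first by rewrite connect0.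
case/andP=> pb1 pu pb [p0 p0s p0p]; have /and3P[ab _ bt] := pb1.
have p0b := connect_trans p0p (connect1 pb1).
have bb : b \in branch (s f).
  apply/branchP; right; exists f; split=> //; rewrite inE bt andbT.
  by apply/exists_inP; exists p0.
apply: connect_trans (connect1 (class_adjE ab pb bb)) _.
by apply: (IH b pu bb); exists p0.
Qed.

Lemma branch_connected p q : colour p != None -> colour p = colour q ->
  connect (class_adj colour) p q.
Proof.
case cp: (colour p) => [x|//] _ /esym/colourP; have := colourP cp => {cp}.
have to_disc a : a \in branch x -> exists2 b, b \in disc x & connect (class_adj colour) b a.
  case/branchP=> [ax|[f [fE sf af]]]; first by exists a; rewrite ?connect0.
  by have [b bs ba] := reach_connected fE af; exists b => //; rewrite -sf.
move=> /to_disc[a ax ap] /to_disc[b bx bq].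
have sym := sym_connect_sym class_adj_sym.
by rewrite sym in ap; apply: connect_trans ap (connect_trans (disc_branch_connected ax bx) bq).
Qed.

(** Walking along the tube, one cannot stay inside [reach f] until the disc of
    [t f] is met; the step that leaves it ends in that disc. *)
Lemma branch_edge f : f \in edges G -> exists a b,
  [/\ a \in branch (s f), b \in branch (t f) & grid_adj a b].
Proof.
move=> fE; have [p [q [ef /setIP[ps pf] /setIP[qt qf] pq]]] := st fE.
have sf_tf : s f != t f by have := card_edge fE; rewrite {1}ef cards2; case: eqP.
have tdisc a : a \in disc (t f) -> a \in branch (t f) by move=> ?; apply/branchP; left.
have [/existsP[a /existsP[b /and3P[ra rb ab]]]|none] := boolP [exists a, exists b,
   [&& a \in branch (s f), b \in branch (t f) & grid_adj a b]]; first by exists a, b.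
have {}none a b : a \in branch (s f) -> b \in disc (t f) -> ~~ grid_adj a b.
  move=> ra /tdisc rb; apply: contra none => ab; apply/existsP; exists a; apply/existsP.
  by exists b; rewrite ra rb.
have rp : p \in reach f.
  rewrite !inE pf andbT; apply/andP; split.
    by apply/exists_inP; exists p; rewrite ?inE ?ps ?connect0.
  by apply/negP=> /(disc_disjoint model ps) e; rewrite e eqxx in sf_tf.
have sub a : a \in reach f -> a \in branch (s f) by move=> ra; apply/branchP; right; exists f.
suff : q \in reach f by rewrite !inE qt andbF.
case/connectP: pq => u + ->; elim: u p {ps pf} rp => [|b u IH] p rp //=.
case/andP=> /and3P[ab _ bf] pu; apply: IH pu.
have bt : b \notin disc (t f) by apply: contraL ab; apply: none; apply: sub.
move: rp; rewrite !inE bf bt => /andP[/exists_inP[p0 p0s p0p] /andP[ptf pf]].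
rewrite !andbT; apply/exists_inP; exists p0 => //; apply: connect_trans p0p (connect1 _).
by rewrite /grid_within ab !inE ptf pf bt bf.
Qed.

Lemma colour_inside p : colour p != None -> (0 < p.1 < n) && (0 < p.2 < n).
Proof.
case cp: (colour p) => [x|//] _; case/branchP: (colourP cp) => [|[f [fE _]]].
  exact: disc_inside.
by rewrite inE => /andP[_ /setDP[pf _]]; apply: tube_inside pf.
Qed.

Lemma branch_grid_minor : exists (col : point n -> option G) rho, grid_minor (edges G) col rho.
Proof.
have hr f : exists e : grid_edge n, f \in edges G -> exists x y,
    [/\ x != y, f = [set x; y], colour (src e) = Some x & colour (tgt e) = Some y].
  have [fE|_] := boolP (f \in edges G); last by exists (true, (Ordinal n_gt0, Ordinal n_gt0)).
  have [a [b [ra rb /existsP[e ends]]]] := branch_edge fE; exists e => _.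
  have [_ [_ [ef _ _ _]]] := st fE.
  have sf_tf : s f != t f by have := card_edge fE; rewrite {1}ef cards2; case: eqP.
  case/orP: ends => /andP[/eqP-> /eqP->].
    by exists (s f), (t f); rewrite (colourE ra) (colourE rb).
  by exists (t f), (s f); rewrite (colourE ra) (colourE rb) eq_sym setUC.
have [rho hrho] := fin_all_exists hr.
exists colour, rho; split; [exact: colour_inside | exact: branch_connected | exact: hrho].
Qed.
End Branch.

Theorem pixel_grid_minor :
  exists (col : point n -> option G) rho, grid_minor (edges G) col rho.
Proof.
have [x0 _|G0] := pickP (@predT G); last first.
  exists (fun=> None), (fun=> (true, (Ordinal n_gt0, Ordinal n_gt0))); split=> // f.
  by case/edgesP=> x; have := G0 x.
have h f : exists xy : G * G, f \in edges G -> exists p q,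
    [/\ f = [set xy.1; xy.2], p \in disc xy.1 :&: tube f, q \in disc xy.2 :&: tube f &
      connect (grid_within (tube f)) p q].
  have [fE|fE] := boolP (f \in edges G); last by exists (x0, x0).
  by have [x [y [p [q ?]]]] := tube_joins model fE; exists (x, y) => _; exists p, q.
have [st hst] := fin_all_exists h.
exact: (@branch_grid_minor (fun f => (st f).1) (fun f => (st f).2) hst).
Qed.
End PixelModel.

(** * Boxes of lattice points *)

Lemma grid_within_sym n (D : {set point n}) : connect_sym (grid_within D).
Proof.
by apply: sym_connect_sym => p q; rewrite /grid_within grid_adj_sym [(p \in D) && _]andbC.
Qed.

Section Segments.
Variables (n : nat) (D : {set point n}).

Lemma grid_adj_right k (j : 'I_n.+1) : k < n -> j < n -> grid_adj (inord k, j) (inord k.+1, j).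
Proof.
move=> kn jn; apply/existsP; exists (true, (Ordinal kn, Ordinal jn)).
apply/orP; left; rewrite /src /tgt /= !xpair_eqE -!val_eqE /= !inordK ?ltnS ?eqxx //.
exact: ltnW.
Qed.

Lemma grid_adj_up k (i : 'I_n.+1) : k < n -> i < n -> grid_adj (i, inord k) (i, inord k.+1).
Proof.
move=> kn jn; apply/existsP; exists (false, (Ordinal jn, Ordinal kn)).
apply/orP; left; rewrite /src /tgt /= !xpair_eqE -!val_eqE /= !inordK ?ltnS ?eqxx //.
exact: ltnW.
Qed.

Lemma connect_right i i' (j : 'I_n.+1) : i <= i' -> i' <= n -> j < n ->
  (forall k, i <= k <= i' -> (inord k, j) \in D) ->
  connect (grid_within D) (inord i, j) (inord i', j).
Proof.
move=> + + jn; elim: i' => [|i' IH] le len inD.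
  by move: le; rewrite leqn0 => /eqP->.
move: le; rewrite leq_eqVlt => /orP[/eqP->//|lt].
have lt' : i <= i' by rewrite -ltnS.
apply: connect_trans (IH lt' (ltnW len) _) (connect1 _).
  by move=> k /andP[ik ki]; apply: inD; rewrite ik (leqW ki).
by rewrite /grid_within grid_adj_right // !inD ?lt' ?leqnn ?leqnSn ?(leqW lt').
Qed.

Lemma connect_up i i' (j : 'I_n.+1) : i <= i' -> i' <= n -> j < n ->
  (forall k, i <= k <= i' -> (j, inord k) \in D) ->
  connect (grid_within D) (j, inord i) (j, inord i').
Proof.
move=> + + jn; elim: i' => [|i' IH] le len inD.
  by move: le; rewrite leqn0 => /eqP->.
move: le; rewrite leq_eqVlt => /orP[/eqP->//|lt].
have lt' : i <= i' by rewrite -ltnS.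
apply: connect_trans (IH lt' (ltnW len) _) (connect1 _).
  by move=> k /andP[ik ki]; apply: inD; rewrite ik (leqW ki).
by rewrite /grid_within grid_adj_up // !inD ?lt' ?leqnn ?leqnSn ?(leqW lt').
Qed.
End Segments.

Section Boxes.
Local Open Scope ring_scope.
Variables (R : realType) (eps L : R) (n : nat).
Hypothesis eps_gt0 : 0 < eps.
Definition lattice (k : nat) : R := eps * k%:R - L.
Definition box (a : R * R) (e : R) : {set point n} :=
  [set p : point n | (`|lattice p.1 - a.1| <= e) && (`|lattice p.2 - a.2| <= e)].

Lemma lattice_le i j : (i <= j)%N -> lattice i <= lattice j.
Proof. by move=> ij; rewrite lerD2r ler_pM2l // ler_nat. Qed.

Lemma lattice_between i j k (c e : R) : (i <= k <= j)%N ->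
  `|lattice i - c| <= e -> `|lattice j - c| <= e -> `|lattice k - c| <= e.
Proof.
move=> /andP[/lattice_le ik /lattice_le kj]; rewrite !ler_distl => /andP[i1 _] /andP[_ j2].
by rewrite (le_trans i1 ik) (le_trans kj j2).
Qed.

(** Walk horizontally, then vertically: boxes are convex. *)
Lemma box_connected a e : (forall p : point n, p \in box a e -> (p.1 < n)%N && (p.2 < n)%N) ->
  forall p q, p \in box a e -> q \in box a e -> connect (grid_within (box a e)) p q.
Proof.
move=> inside.
have right (i i' j : 'I_n.+1) : (i <= i')%N -> (i, j) \in box a e -> (i', j) \in box a e ->
    connect (grid_within (box a e)) (i, j) (i', j).
  move=> ii' pi pi'; have /andP[/= _ jn] := inside _ pi.
  rewrite -(inord_val i) -(inord_val i'); apply: connect_right => //.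
    by rewrite -ltnS.
  move=> k /andP[ik ki]; have kn : (k < n.+1)%N by apply: leq_ltn_trans ki _.
  move: pi pi'; rewrite !inE /= inordK // => /andP[pi ->] /andP[pi' _].
  by rewrite andbT (lattice_between (i := i) (j := i')) // ik.
have up (i i' j : 'I_n.+1) : (i <= i')%N -> (j, i) \in box a e -> (j, i') \in box a e ->
    connect (grid_within (box a e)) (j, i) (j, i').
  move=> ii' pi pi'; have /andP[/= jn _] := inside _ pi.
  rewrite -(inord_val i) -(inord_val i'); apply: connect_up => //.
    by rewrite -ltnS.
  move=> k /andP[ik ki]; have kn : (k < n.+1)%N by apply: leq_ltn_trans ki _.
  move: pi pi'; rewrite !inE /= inordK // => /andP[-> pi] /andP[_ pi'].
  by rewrite (lattice_between (i := i) (j := i')) // ik.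
move=> [p1 p2] [q1 q2] pb qb.
have mb : (q1, p2) \in box a e by move: pb qb; rewrite !inE => /andP[_ ->] /andP[-> _].
apply: (@connect_trans _ _ (q1, p2)).
  have [le|/ltnW le] := leqP p1 q1; first exact: right.
  by rewrite grid_within_sym; apply: right.
have [le|/ltnW le] := leqP p2 q2; first exact: up.
by rewrite grid_within_sym; apply: up.
Qed.

Lemma boxS a e e' : e <= e' -> box a e \subset box a e'.
Proof.
by move=> ee; apply/subsetP=> p; rewrite !inE => /andP[/le_trans-> // /le_trans->].
Qed.
End Boxes.

(** * Compactness and connectedness *)

Section PlaneTopology.
Local Open Scope classical_set_scope.
Local Open Scope ring_scope.

(** A point of [A] has a ball free of [C], and a ball of half the size around
    each nearby point is still free of [C]; compactness makes the size
    uniform. *)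
Lemma compact_closed_apart (R : realType) (M : pseudoMetricType R) (A C : set M) :
  compact A -> closed C -> (forall a, A a -> ~ C a) ->
  exists2 d : R, 0 < d & forall a b, A a -> C b -> ~ ball a d b.
Proof.
move=> /compact_near_coveringP cA clC AC.
have : \forall d \near 0^'+, A `<=` (fun a => forall b, C b -> ~ ball a d b).
  apply: cA => a Aa.
  have : nbhs a (~` C).
    apply: open_nbhs_nbhs; split; first exact: closed_openC.
    exact: AC.
  move=> /nbhs_ballP[e /= e0 be].
  near=> a' d => b Cb ab; apply: (be b) => //.
  have a1 : ball a (e / 2) a' by near: a'; apply: nbhsx_ballx; rewrite divr_gt0.
  have de : d <= e / 2 by near: d; apply: nbhs_right_le; rewrite divr_gt0.
  exact: (ball_split a1) (le_ball de ab).
move=> H; near (0 : R)^'+ => d; exists d; first by near: d; exact: nbhs_right_gt.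
move=> a b Aa; have : A `<=` (fun a => forall b, C b -> ~ ball a d b) by near: d.
exact.
Unshelve. all: by end_near. Qed.

(** The set of times at which [P] holds is open and closed in the segment, which
    is connected. *)
Lemma segment_induction (R : realType) (P : set R) : P 0 ->
  (forall t : R, t \in `[0, 1] -> exists2 e : R, 0 < e &
     forall u : R, u \in `[0, 1] -> ball t e u -> P t <-> P u) ->
  forall t : R, t \in `[0, 1] -> P t.
Proof.
move=> P0 loc.
pose U (Q : set R) : set R := [set u | exists t e : R, [/\ t \in `[0, 1], 0 < e, Q t, ball t e u &
  forall u : R, u \in `[0, 1] -> ball t e u -> P t <-> P u]].
have Uo Q : open (U Q).
  rewrite openE => u [t [e [t01 e0 Qt bu h]]].
  have : nbhs u (ball t e) by apply: open_nbhs_nbhs; split => //; apply: ball_open.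
  by apply: filterS => v bv; exists t, e.
have Us (Q : set R) t : t \in `[0, 1] -> Q t -> U Q t.
  by move=> t01 Qt; have [e e0 h] := loc t t01; exists t, e; split=> //; apply: ballxx.
have := @segment_connected R 0 1.
move=> /(_ (`[0, 1] `&` P)) conn.
suff e : `[0, 1] `&` P = `[0, 1]%classic.
  by move=> t t01; have : (`[0, 1]%classic : set R) t by []; rewrite -e => -[].
apply: conn.
- by exists 0; split=> //=; rewrite in_itv /= lexx ler01.
- exists (U P) => //; apply/seteqP; split=> t [t01 h]; split=> //; first exact: Us.
  by case: h => s [e [s01 e0 Ps bt /(_ t t01 bt) <-]].
exists (~` U (~` P)); first exact: open_closedC.
apply/seteqP; split=> t [t01 h]; split=> //.
  case=> s [e [s01 e0 Ps bt /(_ t t01 bt) [_ k]]].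
  by apply: Ps; apply: k.
by apply: contrapT => nP; apply: h; apply: Us.
Qed.

Lemma within_continuous_ball (R : realType) (M : pseudoMetricType R) (f : R -> M) (t e : R) :
  {within `[0, 1], continuous f} -> t \in `[0, 1] -> 0 < e ->
  exists2 d : R, 0 < d & forall u : R, u \in `[0, 1] -> ball t d u -> ball (f t) e (f u).
Proof.
move=> /subspace_continuousP cf t01 e0.
have := cf t t01 (ball (f t) e) (nbhsx_ballx _ _ e0).
rewrite /= /nbhs /= /within => /nbhs_ballP[d /= d0 h]; exists d => // u u01 bu.
exact: (h u bu u01).
Qed.
End PlaneTopology.

(** * Pixelating a plane drawing *)

Section FiniteRadius.
Local Open Scope ring_scope.

Lemma finite_radius (R : realFieldType) (I : finType) (P : I -> R -> Prop) :
  (forall i, exists2 e : R, 0 < e & forall d : R, 0 < d <= e -> P i d) ->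
  exists2 e : R, 0 < e & forall i (d : R), 0 < d <= e -> P i d.
Proof.
move=> hP; suff [e e0 he] : exists2 e : R, 0 < e & forall i (d : R), i \in enum I -> 0 < d <= e -> P i d.
  by exists e => // i d; apply: he; rewrite mem_enum.
elim: (enum I) => [|i s [e e0 he]]; first by exists 1.
have [e' e'0 he'] := hP i; exists (Num.min e e'); first by rewrite lt_min e0.
move=> j d; rewrite inE le_min => /orP[/eqP->|js] /and3P[d0 d1 d2].
  by apply: he'; rewrite d0.
by apply: he => //; rewrite d0.
Qed.

Lemma plane_ballE (R : realType) (a b : R * R) (e : R) :
  ball a e b <-> `|a.1 - b.1| < e /\ `|a.2 - b.2| < e.
Proof. by rewrite /ball /= /prod_ball -!ball_normE /ball_ /=. Qed.

End FiniteRadius.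

Section Pixels.
Local Open Scope ring_scope.
Variables (R : realType) (eps L : R) (n : nat).
Hypothesis eps_gt0 : 0 < eps.
Notation box := (box eps L n).

Lemma box_ball (p : point n) (a b : R * R) (e e' d : R) :
  p \in box a e -> p \in box b e' -> e + e' < d -> ball a d b.
Proof.
rewrite !inE => /andP[a1 a2] /andP[b1 b2] ed; apply/plane_ballE.
have key (u v w : R) : `|u - v| <= e -> `|u - w| <= e' -> `|v - w| < d.
  move=> uv uw; apply: le_lt_trans ed; apply: le_trans (ler_distD u v w) _.
  by rewrite lerD // distrC.
by split; [apply: key a1 b1 | apply: key a2 b2].
Qed.

Lemma box_shift (p : point n) (a b : R * R) (e d : R) :
  p \in box a e -> ball b d a -> p \in box b (e + d).
Proof.
rewrite !inE => /andP[a1 a2] /plane_ballE[/ltW b1 /ltW b2].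
have key (u v w : R) : `|u - v| <= e -> `|w - v| <= d -> `|u - w| <= e + d.
  move=> uv vw; apply: le_trans (ler_distD v u w) _.
  by rewrite lerD // distrC.
by apply/andP; split; [apply: key a1 b1 | apply: key a2 b2].
Qed.

Variable W : R.
Hypothesis L_large : W + 3%:R * eps <= L.
Hypothesis n_large : L + W + 2%:R * eps < eps * n%:R.

Lemma box_inside (a : R * R) (e : R) (p : point n) :
  `|a.1| <= W + 2%:R * eps - e -> `|a.2| <= W + 2%:R * eps - e -> p \in box a e ->
  (0 < p.1 < n)%N && (0 < p.2 < n)%N.
Proof.
have key (v : R) (k : nat) : `|v| <= W + 2%:R * eps - e -> `|lattice eps L k - v| <= e ->
    (0 < k < n)%N.
  rewrite ler_norml ler_distl /lattice => /andP[v1 v2] /andP[lo hi].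
  have [k0 kn] : 0 < eps * k%:R /\ eps * k%:R < eps * n%:R.
    by move: eps_gt0 L_large n_large => e0 hL hn; split; lra.
  by rewrite -!(ltr_nat R) -(ltr_pM2l eps_gt0) mulr0 k0 -(ltr_pM2l eps_gt0).
by move=> h1 h2; rewrite inE => /andP[/(key _ _ h1)-> /(key _ _ h2)->].
Qed.

Lemma box_nonempty (a : R * R) : `|a.1| <= W -> `|a.2| <= W -> exists p, p \in box a eps.
Proof.
have key (v : R) : `|v| <= W -> exists k : 'I_n.+1, `|lattice eps L k - v| <= eps.
  rewrite ler_norml => /andP[v1 v2].
  move: (eps_gt0) (L_large) (n_large) => e0 hL hn.
  have q0 : 0 <= (v + L) / eps by rewrite divr_ge0 ?ltW //; lra.
  have /andP[lo hi] := truncn_itv q0; set k := Num.truncn _ in lo hi.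
  rewrite ler_pdivlMr // mulrC in lo; rewrite ltr_pdivrMr // mulrC in hi.
  have kn : (k < n.+1)%N.
    by apply: ltnW; rewrite ltnS -(ltr_nat R) -(ltr_pM2l eps_gt0); lra.
  exists (Ordinal kn); rewrite /lattice /= ler_distl.
  rewrite -natr1 in hi; apply/andP; split; lra.
by move=> /key[k1 h1] /key[k2 h2]; exists (k1, k2); rewrite inE h1.
Qed.
End Pixels.

Section Drawing.
Local Open Scope ring_scope.
Variables (R : realType) (G : sgraph) (pos : G -> R * R) (curve : {set G} -> R -> R * R).
Hypothesis D : plane_drawing pos curve.
Notation T := {set G}.

Lemma seg0 : (0 : R) \in `[0, 1]. Proof. by rewrite in_itv /= lexx ler01. Qed.
Lemma seg1 : (1 : R) \in `[0, 1]. Proof. by rewrite in_itv /= lexx ler01. Qed.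

Lemma curve_compact f : f \in edges G -> compact (curve f @` `[0, 1])%classic.
Proof.
by move=> fE; apply: continuous_compact (drawing_continuous D fE) (@segment_compact _ _ _).
Qed.

Lemma curve_pos f t x : f \in edges G -> t \in `[0, 1] -> curve f t = pos x -> x \in f.
Proof.
move=> fE t01 e; have [a [b [ef f0 f1]]] := drawing_ends D fE.
move: t01; rewrite in_itv /= !le_eqVlt => /andP[/orP[/eqP t0|t0] /orP[/eqP t1|t1]].
- by move: e; rewrite -t0 f0 => /(drawing_pos_inj D) <-; rewrite ef set21.
- by move: e; rewrite -t0 f0 => /(drawing_pos_inj D) <-; rewrite ef set21.
- by move: e; rewrite t1 f1 => /(drawing_pos_inj D) <-; rewrite ef set22.
by case: (drawing_avoids_vertices D fE (t := t) (x := x)); rewrite ?in_itv /= ?t0.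
Qed.

Lemma vertex_radius : exists2 r : R, 0 < r & forall x y, x != y -> ~ ball (pos x) r (pos y).
Proof.
have [[x y]|r r0 hr] := @finite_radius R (G * G)%type
  (fun xy d => xy.1 != xy.2 -> ~ ball (pos xy.1) d (pos xy.2)).
  have [->|xy] := eqVneq x y; first by exists 1 => // d _; rewrite eqxx.
  have [|||d d0 hd] := @compact_closed_apart R (R * R)%type [set pos x]%classic [set pos y]%classic.
  - exact: compact_set1.
  - exact: compact_closed (@norm_hausdorff _ _) (@compact_set1 _ _).
  - by move=> a /= -> /(drawing_pos_inj D) e; rewrite e eqxx in xy.
  exists d => // e /andP[e0 ed] _ /(le_ball ed); exact: hd.
by exists r => // x y xy; apply: (hr (x, y)); rewrite ?r0 /=.
Qed.

Lemma vertex_curve_radius : exists2 r : R, 0 < r & forall f x (t : R), f \in edges G -> x \notin f ->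
  t \in `[0, 1] -> ~ ball (curve f t) r (pos x).
Proof.
have [[f x]|r r0 hr] := @finite_radius R (T * G)%type
  (fun fx d => fx.1 \in edges G -> fx.2 \notin fx.1 -> forall t : R, t \in `[0, 1] ->
    ~ ball (curve fx.1 t) d (pos fx.2)).
  have [fE|_] := boolP (f \in edges G); last by exists 1.
  have [xf|xf] := boolP (x \in f); first by exists 1 => // d _ _; rewrite xf.
  have [|||d d0 hd] := @compact_closed_apart R (R * R)%type (curve f @` `[0, 1])%classic [set pos x]%classic.
  - exact: curve_compact.
  - exact: compact_closed (@norm_hausdorff _ _) (@compact_set1 _ _).
  - move=> a /= [t t01 <-] /(curve_pos fE t01) xf'.
    by rewrite xf' in xf.
  exists d => // e /andP[e0 ed] _ _ t t01 /(le_ball ed); apply: hd => //.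
  by exists t.
by exists r => // f x t fE xf; apply: (hr (f, x)); rewrite ?r0 /=.
Qed.

(** Outside the open discs of radius [r] around the vertices, the curve of [f]
    is compact, and it is disjoint from the curve of [h]: the ends of both
    curves lie in these discs, and their interiors do not cross. *)
Lemma curve_curve_radius (r : R) : 0 < r -> exists2 d : R, 0 < d &
  forall f h (s t : R), f \in edges G -> h \in edges G -> f != h -> s \in `[0, 1] -> t \in `[0, 1] ->
    ball (curve f s) d (curve h t) -> exists x, ball (pos x) r (curve f s).
Proof.
move=> r0.
have [[f h]|d d0 hd] := @finite_radius R (T * T)%type
  (fun fh d => fh.1 \in edges G -> fh.2 \in edges G -> fh.1 != fh.2 -> forall s t : R,
    s \in `[0, 1] -> t \in `[0, 1] ->
    ball (curve fh.1 s) d (curve fh.2 t) -> exists x, ball (pos x) r (curve fh.1 s)); last first.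
  by exists d => // f h s t fE hE fh s01 t01; apply: (hd (f, h)); rewrite ?d0 /=.
have [fE|_] := boolP (f \in edges G); last by exists 1.
have [hE|_] := boolP (h \in edges G); last by exists 1.
have [->|fh] := eqVneq f h; first by exists 1 => // d _ _ _; rewrite eqxx.
pose O := (\bigcup_x (ball (pos x) r : set (R * R)))%classic.
have Oo : open O by apply: bigcup_open => x _; apply: ball_open.
have end_in (k : T) u : k \in edges G -> u \in `[0, 1] -> u \notin `]0, 1[ -> O (curve k u).
  move=> kE u01 uo; have [a [b [_ k0 k1]]] := drawing_ends D kE.
  move: u01 uo; rewrite !in_itv /= !le_eqVlt negb_and => /andP[/orP[/eqP<-|u0] /orP[/eqP u1|u1]].
  - by move=> _; exists a => //; rewrite k0; apply: ballxx.
  - by move=> _; exists a => //; rewrite k0; apply: ballxx.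
  - by move=> _; exists b => //; rewrite u1 k1; apply: ballxx.
  by rewrite u0 u1.
have [|||d d0 hd] := @compact_closed_apart R (R * R)%type
   (curve f @` `[0, 1] `&` ~` O)%classic (curve h @` `[0, 1])%classic.
- apply: compact_closedI; first exact: curve_compact.
  exact: open_closedC.
- apply: compact_closed; [exact: norm_hausdorff | exact: curve_compact].
- move=> a [[s s01 <-] nO] [t t01 e].
  have [so|so] := boolP (s \in `]0, 1[); last by apply: nO; apply: end_in.
  have [to|to] := boolP (t \in `]0, 1[); last by apply: nO; rewrite -e; apply: end_in.
  by apply: (drawing_no_crossing D fE hE fh so to).
exists d => // e /andP[e0 ed] _ _ _ s t s01 t01 /(le_ball ed) b.
have [[x _ bx]|nO] := pselect (O (curve f s)); first by exists x.
by case: (hd (curve f s) (curve h t) _ _ b); [split=> //; exists s | exists t].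
Qed.

Lemma drawing_bounded : exists W : R, (forall f (t : R), f \in edges G -> t \in `[0, 1] ->
    `|(curve f t).1| <= W /\ `|(curve f t).2| <= W) /\
  (forall x, `|(pos x).1| <= W /\ `|(pos x).2| <= W).
Proof.
have pr (a : R * R) (W : R) : `|a| <= W -> `|a.1| <= W /\ `|a.2| <= W.
  by rewrite prod_normE ge_max => /andP[].
have [f|d d0 hd] := @finite_radius R T (fun f d => f \in edges G -> forall t : R, t \in `[0, 1] ->
    `|curve f t| <= d^-1).
  have [fE|_] := boolP (f \in edges G); last by exists 1.
  have [M [_ hM]] := compact_bounded (curve_compact fE).
  have M1 : 0 < `|M| + 1 by rewrite ltr_wpDl.
  exists (`|M| + 1)^-1; first by rewrite invr_gt0.
  move=> d /andP[d0 dM] _ t t01; apply: hM; last by exists t.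
  rewrite (lt_le_trans (_ : M < `|M| + 1)) //.
    by rewrite (le_lt_trans (ler_norm M)) // ltrDl.
  by rewrite -[leLHS]invrK lef_pV2 // posrE invr_gt0.
have [x|d' d'0 hd'] := @finite_radius R G (fun x d => `|pos x| <= d^-1).
  exists (`|pos x| + 1)^-1; first by rewrite invr_gt0 ltr_wpDl.
  move=> e /andP[e0 ed]; rewrite (le_trans (_ : _ <= `|pos x| + 1)) //; first by rewrite lerDl.
  by rewrite -[leLHS]invrK lef_pV2 // posrE ?invr_gt0 ?ltr_wpDl.
exists (d^-1 + d'^-1); split=> [f t fE t01|x]; apply: pr.
  by apply: ler_wpDr; [rewrite invr_ge0 ltW | apply: hd; rewrite // d0 lexx].
by apply: ler_wpDl; [rewrite invr_ge0 ltW | apply: hd'; rewrite d'0 lexx].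
Qed.

(** The lattice has mesh [eps], the discs have radius [r] and the tubes radius
    [2 eps]. The disc radius keeps discs apart from each other and from the
    curves of edges not ending there, and [eps] is so small that tubes of two
    edges can only meet close to a vertex. A tube is connected because
    consecutive lattice points along the curve lie in a common box. *)
Theorem drawing_grid_minor : exists n (col : point n -> option G) rho, grid_minor (edges G) col rho.
Proof.
have [r1 r1_gt0 hr1] := vertex_radius.
have [r2 r2_gt0 hr2] := vertex_curve_radius.
have [W0 [hW1 hW2]] := drawing_bounded.
have [r [r_gt0 r_r1 r_r2]] : exists r : R, [/\ 0 < r, 3%:R * r <= r1 & 3%:R * r <= r2].
  exists (Num.min (r1 / 3%:R) (r2 / 3%:R)); split.
  - by rewrite lt_min !divr_gt0 ?ltr0n.
  - by rewrite mulrC -ler_pdivlMr ?ltr0n // ge_min lexx.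
  - by rewrite mulrC -ler_pdivlMr ?ltr0n // ge_min lexx orbT.
have [|d d_gt0 hd] := @curve_curve_radius (r / 2%:R).
  by rewrite divr_gt0 ?ltr0n.
have [eps [eps_gt0 eps_r eps_d]] : exists eps : R, [/\ 0 < eps, 4%:R * eps <= r & 5%:R * eps <= d].
  exists (Num.min (r / 4%:R) (d / 5%:R)); split.
  - by rewrite lt_min !divr_gt0 ?ltr0n.
  - by rewrite mulrC -ler_pdivlMr ?ltr0n // ge_min lexx.
  - by rewrite mulrC -ler_pdivlMr ?ltr0n // ge_min lexx orbT.
(* the margin of [3 eps] keeps all discs and tubes strictly inside the grid *)
pose W := W0 + r; pose L := W + 3%:R * eps.
pose n := (Num.truncn ((L + W + 2%:R * eps) / eps)).+1.
have hn : L + W + 2%:R * eps < eps * n%:R.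
  by rewrite [ltRHS]mulrC -ltr_pdivrMr //; apply: truncnS_gt.
have hL : W + 3%:R * eps <= L by [].
have r_W : W0 <= W by rewrite lerDl ltW.
pose disc x := box eps L n (pos x) r.
pose tube f : {set point n} := [set p | `[< exists2 t : R, t \in `[0, 1] & p \in box eps L n (curve f t) (2%:R * eps) >]].
have disc_in x p : p \in disc x -> (0 < p.1 < n)%N && (0 < p.2 < n)%N.
  have [h1 h2] := hW2 x; have le : W0 <= W + 2%:R * eps - r by rewrite /W; lra.
  exact: (box_inside eps_gt0 hL hn (le_trans h1 le) (le_trans h2 le)).
have box_in f t p : f \in edges G -> t \in `[0, 1] -> p \in box eps L n (curve f t) (2%:R * eps) ->
    (0 < p.1 < n)%N && (0 < p.2 < n)%N.
  move=> fE t01; have [h1 h2] := hW1 f t fE t01.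
  have le : W0 <= W + 2%:R * eps - 2%:R * eps by rewrite /W; lra.
  exact: (box_inside eps_gt0 hL hn (le_trans h1 le) (le_trans h2 le)).
have tubeP f p : reflect (exists2 t : R, t \in `[0, 1] & p \in box eps L n (curve f t) (2%:R * eps)) (p \in tube f).
  by rewrite inE; apply: (iffP (asboolP _)).
exists n; apply: (@pixel_grid_minor G n disc tube) => //; split=> //.
- by move=> f p fE /tubeP[t t01]; apply: box_in.
- move=> x; apply: box_connected => // p /disc_in /andP[/andP[_ ->] /andP[_ ->]] //.
- move=> x y p px py; apply/eqP; apply/negPn/negP=> xy; apply: (hr1 _ _ xy).
  by apply: (box_ball px py); apply: lt_le_trans r_r1; lra.
- move=> f x p fE /tubeP[t t01 pt] px; apply/negPn/negP=> xf; apply: (hr2 f x t fE xf t01).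
  by apply: (box_ball pt px); apply: lt_le_trans r_r2; lra.
- move=> f h p fE hE fh /tubeP[s s01 ps] /tubeP[t t01 pt].
  have [|x bx] := hd f h s t fE hE fh s01 t01.
    by apply: (box_ball ps pt); apply: lt_le_trans eps_d; lra.
  have le : 2%:R * eps + r / 2%:R <= r by lra.
  by exists x; exact: (fintype.subsetP (boxS eps L n (pos x) le) p (box_shift ps bx)).
move=> f fE; have [x [y [ef f0 f1]]] := drawing_ends D fE.
have ne t : t \in `[0, 1] -> exists p, p \in box eps L n (curve f t) eps.
  move=> t01; have [h1 h2] := hW1 f t fE t01.
  by apply: (box_nonempty eps_gt0 hL hn); [apply: le_trans h1 _ | apply: le_trans h2 _].
have [p p0] := ne 0 seg0; have [q q1] := ne 1 seg1; exists x, y, p, q.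
have le12 : eps <= 2%:R * eps by lra.
have sub2 a := fintype.subsetP (boxS eps L n a le12).
have ler : eps <= r by lra.
have sub_tube t : t \in `[0, 1] -> forall u v, u \in box eps L n (curve f t) (2%:R * eps) ->
    v \in box eps L n (curve f t) (2%:R * eps) -> connect (grid_within (tube f)) u v.
  move=> t01 u v ub vb.
  apply: connect_sub (box_connected eps_gt0 _ ub vb) => [a b /and3P[ab ax bx]|w wb].
    by apply: connect1; rewrite /grid_within ab /=; apply/andP; split; apply/tubeP; exists t.
  by have /andP[/andP[_ ->] /andP[_ ->]] := box_in f t w fE t01 wb.
split=> //.
- rewrite inE; apply/andP; split; last by apply/tubeP; exists 0; rewrite ?seg0 //; apply: sub2.
  by rewrite /disc -f0; exact: (fintype.subsetP (boxS eps L n _ ler) p p0).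
- rewrite inE; apply/andP; split; last by apply/tubeP; exists 1; rewrite ?seg1 //; apply: sub2.
  by rewrite /disc -f1; exact: (fintype.subsetP (boxS eps L n _ ler) q q1).
pose P t := forall v, v \in box eps L n (curve f t) (2%:R * eps) -> connect (grid_within (tube f)) p v.
suff : P 1 by apply; apply: sub2.
apply: (@segment_induction R P); last exact: seg1.
  by move=> v; apply: sub_tube; rewrite ?seg0 //; apply: sub2.
have step t u : t \in `[0, 1] -> u \in `[0, 1] -> ball (curve f u) eps (curve f t) -> P t -> P u.
  move=> t01 u01 but Pt v vb; have [c ct] := ne t t01.
  apply: connect_trans (Pt c (sub2 _ _ ct)) (sub_tube u u01 _ _ _ vb).
  have le : eps + eps <= 2%:R * eps by lra.
  exact: (fintype.subsetP (boxS eps L n _ le) c (box_shift ct but)).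
move=> t t01; have [e e0 he] := within_continuous_ball (drawing_continuous D fE) t01 eps_gt0.
exists e => // u u01 bu; have bf := he u u01 bu.
by split; apply: step => //; apply: ball_sym.
Qed.
End Drawing.


(** * The bound for plane graphs *)

Theorem theorem1p4 (R : realType) (g : nat) (G : sgraph) (b : nat)
  (g_gt0 : 0 < g)
  (G_planar : planar R G)
  (G_girth : girth_at_least G g)
  (G_bridges : #|bridges G| = b) :
  fvs G <= (#|edges G| - b) %/ g.
Proof.
case: G_planar => pos [curve D]; have [n [col [rho minor]]] := drawing_grid_minor D.
rewrite leq_divRL // mulnC -G_bridges.
exact: (@fvs_bound 'F_2 G (pchar_Fp (isT : prime 2)) g n col rho G_girth minor).
Qed.
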